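(* Let $\gamma\in\mathbb{R}\setminus\{0\}$ with $|\gamma|\leq 1$, and let $H$ be the operator on $L^2(\mathbb{R})$ given by $$H=-\frac{1}{4}\frac{\partial^2}{\partial x^2}+x^2-\gamma\left(\frac{1}{2}+x\frac{\partial}{\partial x}\right)$$ on the domain $\mathcal{D}=\{\Psi\in L^2(\mathbb{R}):\ \Psi \text{ has weak first and second derivatives in } L^2(\mathbb{R}),\ x^2\Psi(x)\in L^2(\mathbb{R})\}$. Then $H$ is $m$-accretive.
   Context: $L^2(\mathbb{R})$ carries the inner product $\langle f,g\rangle=\int_{-\infty}^{\infty}f(x)\overline{g(x)}\,dx$. The numerical range of $H$ is $W(H)=\{\langle H\psi,\psi\rangle:\ \psi\in\mathcal{D},\ \|\psi\|=1\}$. An operator $H$ is called $m$-accretive if its numerical range is contained in the closed right half-plane $\{z\in\mathbb{C}:\Re z\geq 0\}$ and the resolvent bound holds: for every $\lambda\in\mathbb{C}$ with $\Re\lambda<0$, the operator $H-\lambda$ has a bounded inverse with $\|(H-\lambda)^{-1}\|\leq 1/|\Re\lambda|$. *)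

(* Defs.v *)
From mathcomp Require Import all_boot all_algebra.
From mathcomp Require Import all_classical all_reals all_analysis.
From mathcomp Require Import complex.
Import GRing.Theory Num.Theory ComplexField.
Local Open Scope ring_scope.

Section Defs.
Variable R : realType.
Local Notation mu := (@lebesgue_measure R).

Definition cR (r : R) : R[i] := Complex r 0.

Definition cabs2 (z : R[i]) : R := complex.Re z ^+ 2 + complex.Im z ^+ 2.

Definition L2 (f : R -> R[i]) : Prop :=
  measurable_fun setT (fun x => complex.Re (f x)) /\
  measurable_fun setT (fun x => complex.Im (f x)) /\
  mu.-integrable setT (fun x => (cabs2 (f x))%:E).

Definition L2norm (f : R -> R[i]) : R :=
  Num.sqrt (Rintegral mu setT (fun x => cabs2 (f x))).

Definition inner (f g : R -> R[i]) : R[i] :=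
  Complex (Rintegral mu setT (fun x => complex.Re (f x * conjc (g x))))
          (Rintegral mu setT (fun x => complex.Im (f x * conjc (g x)))).

Definition test_fun (phi : R -> R) : Prop :=
  (forall (n : nat) (x : R), derivable (derive1n n phi) x 1) /\
  exists M : R, forall x : R, M < `|x| -> phi x = 0.

Definition weak_deriv (f g : R -> R[i]) : Prop :=
  forall phi : R -> R, test_fun phi ->
    Rintegral mu setT (fun x => complex.Re (f x) * derive1 phi x)
      = - Rintegral mu setT (fun x => complex.Re (g x) * phi x) /\
    Rintegral mu setT (fun x => complex.Im (f x) * derive1 phi x)
      = - Rintegral mu setT (fun x => complex.Im (g x) * phi x).

(* Hrel gamma psi h  :<=>  psi is in the domain D and h = H psi
   (h is determined up to a.e. equality, as an element of L^2) where
   H = -1/4 d^2/dx^2 + x^2 - gamma (1/2 + x d/dx). *)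
Definition Hrel (gamma : R) (psi h : R -> R[i]) : Prop :=
  L2 psi /\ L2 (fun x => cR (x ^+ 2) * psi x) /\
  exists d1 d2 : R -> R[i],
    L2 d1 /\ L2 d2 /\ weak_deriv psi d1 /\ weak_deriv d1 d2 /\
    forall x : R,
      h x = - (cR (1 / 4)) * d2 x + cR (x ^+ 2) * psi x
            - cR gamma * (psi x / cR 2 + cR x * d1 x).

Definition m_accretive_H (gamma : R) : Prop :=
  (forall psi h : R -> R[i], Hrel gamma psi h -> L2norm psi = 1 ->
     0 <= complex.Re (inner h psi)) /\
  (* resolvent: for Re lambda < 0, H - lambda : D -> L^2 is bijective
     (modulo a.e. equality) with inverse of norm <= 1/|Re lambda| *)
  (forall lam : R[i], complex.Re lam < 0 ->
     (forall g : R -> R[i], L2 g ->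
        exists psi h : R -> R[i], Hrel gamma psi h /\
          {ae mu, forall x, h x - lam * psi x = g x}) /\
     (forall psi h : R -> R[i], Hrel gamma psi h ->
        {ae mu, forall x, h x - lam * psi x = 0} ->
        {ae mu, forall x, psi x = 0}) /\
     (forall psi h : R -> R[i], Hrel gamma psi h ->
        L2norm psi <= L2norm (fun x => h x - lam * psi x) / `|complex.Re lam|)).

End Defs.

(* Main.v *)
Require Import Defs.
From mathcomp Require Import all_boot all_order all_algebra.
From mathcomp Require Import all_classical all_reals all_analysis.
From mathcomp Require Import measurable_realfun.
From mathcomp Require Import complex ring lra.
Set Implicit Arguments.
Unset Strict Implicit.
Unset Printing Implicit Defensive.
Import Order.TTheory GRing.Theory Num.Theory ComplexField.
Import numFieldNormedType.Exports.
Local Open Scope classical_set_scope.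
Local Open Scope ring_scope.

(* Since [H] has real coefficients, real and imaginary parts are treated separately, and they only
   interact through [Im lambda].

   Accretivity: for real [p] in the domain, [(H p) p] is [p'^2/4 + x^2 p^2] plus the derivative of
   [- p' p/4 - gamma x p^2/2]; this function and its derivative are integrable, so the derivative
   integrates to [0]. By Cauchy-Schwarz, [|Re lambda| |u| <= |(H - lambda) u|] when
   [Re lambda < 0].

   Surjectivity of [H - lambda] at one point: with [s = sqrt (1 + gamma^2)], the operator [H + s/2]
   factors into two first-order operators, which are solved explicitly by Gaussian integrating
   factors; the constant of integration in the first one is chosen such that the solution of the
   second one decays at both ends. A Neumann series propagates surjectivity from [lambda] to the
   disc of radius [|Re lambda|] around it, and hence to the whole half-plane.

   Weak derivatives are turned into primitives by the du Bois-Reymond lemma, where constancy is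
   tested at Lebesgue points against differences of translated approximate identities. *)

(** * Integration on the line *)

Section Integrals.
Variable R : realType.
Local Notation mu := (@lebesgue_measure R).
Implicit Types (D : set R) (f g h : R -> R) (a b c x y : R).

(** The order of the two factors matters. Expanding [(d/2 + a x)(- d/2 + b x)] gives [a b = 1] in
    front of [x^2], [(b - a)/2 = - gamma] in front of [x d/dx] and the constant
    [b/2 = s/2 - gamma/2], hence [H + s/2], that is the point [- s/2] of the left half-plane; the
    opposite order would give [H - s/2]. The left factor annihilates the square-integrable
    [exp (- a x^2)], whereas the range of the right factor is orthogonal to [exp (- b x^2)]: the
    free constant of the first equation pays for the condition imposed by the second.

    The recurrent obstacle is the behaviour at infinity. Membership in the domain says nothing
    directly about [x p'], and no function is known beforehand to decay pointwise. Boundary terms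
    are therefore estimated by averages over unit intervals, which turns integrability of a
    primitive into control of its values.

    The Neumann series converges only in [L^2]. Instead of passing to the limit under [H], its sum
    is put into the right-hand side of an equation that is already solvable. *)

Definition intg D f : Prop := mu.-integrable D (EFin \o f).
Definition Itg D f : R := Rintegral mu D f.

Lemma ae_imp (P Q : R -> Prop) : (forall x, P x -> Q x) ->
  {ae mu, forall x, P x} -> {ae mu, forall x, Q x}.
Proof. by move=> PQ; apply: (@filterS _ _ (ae_filter_ringOfSetsType mu)). Qed.

Lemma ae_imp2 (P Q S : R -> Prop) : (forall x, P x -> Q x -> S x) ->
  {ae mu, forall x, P x} -> {ae mu, forall x, Q x} -> {ae mu, forall x, S x}.
Proof. by move=> PQ; apply: (@filterS2 _ _ (ae_filter_ringOfSetsType mu)). Qed.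

Lemma intg_mfun D f : intg D f -> measurable_fun D f.
Proof. by move/(measurable_int mu)/measurable_EFinP. Qed.

Lemma intg_le D f g : measurable D -> measurable_fun D f -> intg D g ->
  (forall x, D x -> `|f x| <= g x) -> intg D f.
Proof.
move=> mD mf ig fg; apply: (@le_integrable _ _ _ mu _ _ _ (EFin \o g)) => //.
  exact/measurable_EFinP.
by move=> x Dx /=; rewrite lee_fin (le_trans (fg x Dx))// ler_norm.
Qed.

Lemma intg_ext D f g : measurable D -> intg D f -> (forall x, D x -> f x = g x) -> intg D g.
Proof.
move=> mD fi fg; apply: (@eq_integrable _ _ _ mu _ _ (EFin \o f)) => //.
by move=> x; rewrite inE => /fg /= ->.
Qed.

Lemma Itg_ext D f g : (forall x, D x -> f x = g x) -> Itg D f = Itg D g.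
Proof. by move=> fg; apply: eq_Rintegral => x; rewrite inE; exact: fg. Qed.

Lemma intgD D f g : measurable D -> intg D f -> intg D g -> intg D (fun x => f x + g x).
Proof. by move=> mD fi gi; exact: (@integrableD _ _ _ mu D _ (EFin \o f) (EFin \o g)). Qed.

Lemma intgN D f : measurable D -> intg D f -> intg D (fun x => - f x).
Proof. by move=> mD fi; exact: (@integrableN _ _ _ mu D (EFin \o f)). Qed.

Lemma intgB D f g : measurable D -> intg D f -> intg D g -> intg D (fun x => f x - g x).
Proof. by move=> mD fi gi; exact: (@integrableB _ _ _ mu D _ (EFin \o f) (EFin \o g)). Qed.

Lemma intgZ D r f : measurable D -> intg D f -> intg D (fun x => r * f x).
Proof. by move=> mD fi; exact: (@integrableZl _ _ _ mu D _ r (EFin \o f)). Qed.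

Lemma intg_norm D f : measurable D -> intg D f -> intg D (fun x => `|f x|).
Proof. by move=> mD fi; exact: (integrable_norm fi). Qed.

Lemma intgS D D' f : measurable D -> measurable D' -> D' `<=` D -> intg D f -> intg D' f.
Proof. by move=> mD mD' DD; exact: integrableS. Qed.

Lemma intgT D f : measurable D -> intg setT f -> intg D f.
Proof. by move=> mD; exact: intgS. Qed.

Lemma ItgD D f g : measurable D -> intg D f -> intg D g ->
  Itg D (fun x => f x + g x) = Itg D f + Itg D g.
Proof. by move=> mD fi gi; exact: RintegralD. Qed.

Lemma ItgB D f g : measurable D -> intg D f -> intg D g ->
  Itg D (fun x => f x - g x) = Itg D f - Itg D g.
Proof. by move=> mD fi gi; exact: RintegralB. Qed.

Lemma ItgZ D r f : measurable D -> intg D f -> Itg D (fun x => r * f x) = r * Itg D f.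
Proof. by move=> mD fi; exact: RintegralZl. Qed.

Lemma ItgN D f : measurable D -> intg D f -> Itg D (fun x => - f x) = - Itg D f.
Proof.
move=> mD fi; rewrite -[RHS]mulN1r -ItgZ//.
by apply: Itg_ext => x _; rewrite mulN1r.
Qed.

Lemma le_Itg D f g : measurable D -> intg D f -> intg D g ->
  (forall x, D x -> f x <= g x) -> Itg D f <= Itg D g.
Proof. by move=> mD fi gi; exact: (@le_Rintegral _ _ _ mu). Qed.

Lemma Itg_ge0 D f : (forall x, D x -> 0 <= f x) -> 0 <= Itg D f.
Proof. exact: (@Rintegral_ge0 _ _ _ mu). Qed.

Lemma le_norm_Itg D f : measurable D -> intg D f -> `|Itg D f| <= Itg D (fun x => `|f x|).
Proof. by move=> mD fi; exact: le_normr_Rintegral. Qed.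

Lemma EFin_Itg D f : measurable D -> intg D f -> (Itg D f)%:E = (\int[mu]_(x in D) (f x)%:E)%E.
Proof. by move=> mD fi; rewrite /Itg /Rintegral fineK//; exact: integrable_fin_num. Qed.

Lemma Itg_subset D D' f : measurable D -> measurable D' -> D' `<=` D -> intg D f ->
  (forall x, D x -> 0 <= f x) -> Itg D' f <= Itg D f.
Proof.
move=> mD mD' DD fi f0; rewrite -lee_fin !EFin_Itg//; last exact: intgS fi.
apply: ge0_subset_integral => //=.
by apply/measurable_EFinP; exact: intg_mfun.
Qed.

Lemma Itg_chasles a b c f : a <= b -> b <= c -> intg `[a, c] f ->
  Itg `[a, c] f = Itg `[a, b] f + Itg `[b, c] f.
Proof.
move=> ab bc fi.
have := @Rintegral_itvB R f (BLeft a) (BRight c) b fi; rewrite !bnd_simp => /(_ ab bc).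
rewrite (@Rintegral_itv_obnd_cbnd _ b); last first.
  by apply: intgS fi => // x /=; rewrite !in_itv /= => /andP[] bx ->; rewrite (le_trans ab (ltW bx)).
by rewrite /Itg => <-; rewrite addrC subrK.
Qed.

Lemma Itg0 D : Itg D (fun _ => 0) = 0.
Proof. by rewrite /Itg /Rintegral integral0. Qed.

Lemma Itg_point a f : Itg `[a, a] f = 0.
Proof. by rewrite /Itg set_itv1 Rintegral_set1. Qed.

Lemma intg_bounded a b f M : measurable_fun `[a, b] f ->
  (forall x, a <= x <= b -> `|f x| <= M) -> intg `[a, b] f.
Proof.
move=> mf fM; apply: measurable_bounded_integrable => //.
  by rewrite /= lebesgue_measure_itv /=; case: ifP => // _; rewrite -EFinB ltry.
exists M; split; first exact: num_real.
by move=> N MN x /=; rewrite in_itv /= => /fM/le_trans; apply; exact: ltW.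
Qed.

Lemma intg_cst a b M : intg `[a, b] (fun _ => M).
Proof. by apply: (@intg_bounded _ _ _ `|M|). Qed.

Lemma Itg_cst a b M : a <= b -> Itg `[a, b] (fun _ => M) = M * (b - a).
Proof.
move=> ab; rewrite /Itg Rintegral_cst//= lebesgue_measure_itv /=.
move: ab; rewrite le_eqVlt => /predU1P[->|ab]; first by rewrite lte_fin ltxx subrr.
by rewrite lte_fin ab.
Qed.

Lemma intg_mul_bounded D f g M : measurable D -> intg D f -> measurable_fun D g ->
  (forall x, D x -> `|g x| <= M) -> intg D (fun x => f x * g x).
Proof.
move=> mD fi mg gM; apply: (@intg_le _ _ (fun x => M * `|f x|)) => //.
- by apply: measurable_funM => //; exact: intg_mfun.
- by apply: intgZ => //; exact: intg_norm.
- by move=> x Dx; rewrite normrM mulrC ler_wpM2r// gM.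
Qed.

Lemma intg_ae D f g : measurable D -> measurable_fun D g -> intg D f ->
  {ae mu, forall x, D x -> f x = g x} -> intg D g.
Proof.
move=> mD mg fi fg; apply/integrableP; split; first exact/measurable_EFinP.
rewrite (@ae_eq_integral _ _ _ mu _ (fun x => `|(EFin \o f) x|)%E); first last.
- by apply: ae_imp fg => x + Dx => /(_ Dx) /= ->.
- by apply: measurableT_comp => //; exact: (measurable_int mu fi).
- by apply: measurableT_comp => //; exact/measurable_EFinP.
- by [].
- by case/integrableP : fi.
Qed.

Lemma Itg_ae D f g : measurable D -> measurable_fun D f -> measurable_fun D g ->
  {ae mu, forall x, D x -> f x = g x} -> Itg D f = Itg D g.
Proof.
move=> mD mf mg fg; rewrite /Itg /Rintegral; congr fine.
apply: ae_eq_integral => //; [exact/measurable_EFinP|exact/measurable_EFinP|].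
by apply: ae_imp fg => x + Dx => /(_ Dx) ->.
Qed.

Lemma Itg_eq0_ae f : intg setT f -> (forall x, 0 <= f x) -> Itg setT f = 0 ->
  {ae mu, forall x, f x = 0}.
Proof.
move=> fi f0 I0.
have : (\int[mu]_(x in setT) `|(f x)%:E| = 0)%E.
  rewrite -[RHS]/((0:R)%:E) -I0 EFin_Itg//; apply: eq_integral => x _.
  by rewrite gee0_abs// lee_fin.
move/ae_eq_integral_abs => /(_ measurableT) H.
have {}H := H (measurable_int mu fi).
by apply: ae_imp H => x /(_ I) [].
Qed.

Definition L2r f : Prop := measurable_fun setT f /\ intg setT (fun x => f x ^+ 2).

Lemma L2r_cst0 : L2r (fun _ : R => 0).
Proof.
split=> //; apply: (intg_ext (f := fun _ => 0)) => //; first exact: (integrable0 mu).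
by move=> x _; rewrite expr0n.
Qed.

Lemma L2r_mul f g : L2r f -> L2r g -> intg setT (fun x => f x * g x).
Proof.
move=> [mf f2] [mg g2]; apply: (intg_le _ _ (intgD measurableT f2 g2)) => //.
  exact: measurable_funM.
move=> x _; rewrite normrM; have := sqr_ge0 (`|f x| - `|g x|).
rewrite -(real_normK (num_real (f x))) -(real_normK (num_real (g x))).
have := mulr_ge0 (normr_ge0 (f x)) (normr_ge0 (g x)); nra.
Qed.

Lemma L2r_le f g : measurable_fun setT f -> intg setT g ->
  (forall x, f x ^+ 2 <= g x) -> L2r f.
Proof.
move=> mf gi fg; split=> //; apply: (intg_le _ _ gi) => //.
  exact: measurable_funX.
by move=> x _; rewrite ger0_norm ?sqr_ge0.
Qed.

Lemma L2r_ext f g : L2r f -> f =1 g -> L2r g.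
Proof. by move=> + /funext <-. Qed.

Lemma L2rZ r f : L2r f -> L2r (fun x => r * f x).
Proof.
move=> [mf fi]; split; first exact: measurable_funM.
by apply: (intg_ext _ (intgZ (r ^+ 2) _ fi)) => // x _; rewrite exprMn.
Qed.

Lemma L2rD f g : L2r f -> L2r g -> L2r (fun x => f x + g x).
Proof.
move=> Lf Lg; have fg := L2r_mul Lf Lg; move: Lf Lg => [mf fi] [mg gi].
split; first exact: measurable_funD.
have := intgD measurableT (intgD measurableT fi gi) (intgZ 2 measurableT fg).
by move/intg_ext; apply => // x _; ring.
Qed.

Lemma L2rN f : L2r f -> L2r (fun x => - f x).
Proof.
move/(L2rZ (-1)) => H; rewrite (_ : (fun x => _) = (fun x => -1 * f x))//.
by apply/funext => x; rewrite mulN1r.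
Qed.

Lemma L2rB f g : L2r f -> L2r g -> L2r (fun x => f x - g x).
Proof. by move=> Lf Lg; apply: L2rD => //; exact: L2rN. Qed.

Lemma L2r_ae f g : measurable_fun setT g -> L2r f -> {ae mu, forall x, f x = g x} -> L2r g.
Proof.
move=> mg [mf fi] fg; split=> //; apply: (intg_ae _ _ fi) => //.
  exact: measurable_funX.
by apply: ae_imp fg => x ->.
Qed.

Lemma L2r_loc f a b : L2r f -> intg `[a, b] f.
Proof.
move=> [mf fi]; apply: (@intg_le _ _ (fun x => 1 + f x ^+ 2)) => //.
- exact: measurable_funTS.
- by apply: intgD => //; [exact: intg_cst|exact: intgT].
- move=> x _; have := sqr_ge0 (`|f x| - 1); rewrite -(real_normK (num_real (f x))).
  by have := normr_ge0 (f x); nra.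
Qed.

End Integrals.

(** * Absolutely continuous functions *)

Section AC.
Variable R : realType.
Local Notation mu := (@lebesgue_measure R).
Implicit Types (D : set R) (f g h F G : R -> R) (a b c x y : R).

Lemma itv_restrictE a b f :
  f \_ `[a, b] = (fun x => if a <= x <= b then f x else 0).
Proof.
apply/funext => x; rewrite patchE.
case: ifPn => [|/negP]; rewrite inE /= in_itv /=; first by move=> ->.
by move/negP/negbTE => ->.
Qed.

Lemma Itg_if a b f : Itg `[a, b] f = Itg setT (fun x => if a <= x <= b then f x else 0).
Proof. by rewrite /Itg Rintegral_mkcond itv_restrictE. Qed.

Lemma intg_if a b f :
  intg `[a, b] f <-> intg setT (fun x => if a <= x <= b then f x else 0).
Proof.
rewrite /intg -itv_restrictE -restrict_EFin.
exact: (@integrable_mkcond _ _ _ mu).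
Qed.

(** Fubini for [f x * g y] on the triangle [a <= y <= x <= b]. With primitives of [f] and [g] in
    place of the inner integrals, this is integration by parts. *)
Lemma Itg_triangle_swap a b f g : measurable_fun setT f -> measurable_fun setT g ->
  intg `[a, b] f -> intg `[a, b] g ->
  Itg `[a, b] (fun x => f x * Itg `[a, x] g) = Itg `[a, b] (fun y => g y * Itg `[y, b] f).
Proof.
move=> mf mg fi gi.
pose fa x := if a <= x <= b then f x else 0.
pose ga x := if a <= x <= b then g x else 0.
have fai : intg setT fa by exact/intg_if.
have gai : intg setT ga by exact/intg_if.
pose T := measurableTypeR R.
pose K (p : T * T) : R := if (a <= p.2) && (p.2 <= p.1) && (p.1 <= b) then f p.1 * g p.2 else 0.
have mf1 : measurable_fun setT (fun p : T * T => f p.1).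
  exact: (measurableT_comp (f := f : T -> T) mf measurable_fst).
have mg2 : measurable_fun setT (fun p : T * T => g p.2).
  exact: (measurableT_comp (f := g : T -> T) mg measurable_snd).
have mK : measurable_fun setT K.
  apply: measurable_fun_ifT; last 2 first.
  - exact: measurable_funM.
  - exact: measurable_cst.
  apply: measurable_and; first apply: measurable_and.
  - by apply: measurable_fun_ler => //; exact: measurable_snd.
  - by apply: measurable_fun_ler => //; exact: measurable_fst.
  - by apply: measurable_fun_ler => //; exact: measurable_fst.
have Kle x y : `|K (x, y)| <= `|fa x| * `|ga y|.
  rewrite /K /fa /ga /=; case: ifP => [/andP[/andP[ay yx] xb]|_].
    by rewrite ay xb (le_trans ay yx) (le_trans yx xb) normrM.
  by rewrite normr0 mulr_ge0.
have K1 x : intg setT (fun y => K (x, y)).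
  apply: (@intg_le _ _ _ (fun y => `|fa x| * `|ga y|)) => //.
    exact: (measurableT_comp (mK : measurable_fun setT K) (measurable_pair1 x)).
  by apply: intgZ => //; exact: intg_norm.
have K2 y : intg setT (fun x => K (x, y)).
  apply: (@intg_le _ _ _ (fun x => `|ga y| * `|fa x|)) => //.
    exact: (measurableT_comp (mK : measurable_fun setT K) (measurable_pair2 y)).
  - by apply: intgZ => //; exact: intg_norm.
  - by move=> x _; rewrite mulrC Kle.
have iK : (mu \x mu)%E.-integrable setT (EFin \o K).
  apply/integrable12ltyP; first exact/measurable_EFinP.
  apply: (@le_lt_trans _ _ (\int[mu]_x (`|fa x| * Itg setT (fun y => `|ga y|))%:E)%E).
    apply: ge0_le_integral => //.
    - by move=> x _; apply: integral_ge0.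
    - apply: (measurable_fun_fubini_tonelli_F (m2 := mu) (fun p => `|(K p)%:E|%E)) => //.
      by apply: measurableT_comp => //; exact/measurable_EFinP.
    - apply/measurable_EFinP; apply: measurable_funM => //.
      by apply: measurableT_comp => //; exact: intg_mfun fai.
    - move=> x _ /=; rewrite -ItgZ//; last exact: intg_norm.
      rewrite EFin_Itg//; last by apply: intgZ => //; exact: intg_norm.
      apply: ge0_le_integral => //.
      + apply/measurable_EFinP; apply: measurableT_comp => //.
        exact: intg_mfun (K1 x).
      + apply/measurable_EFinP; apply: measurable_funM => //.
        by apply: measurableT_comp => //; exact: intg_mfun gai.
      + by move=> y _; rewrite lee_fin.
  rewrite -EFin_Itg ?ltry//.
  apply: (@intg_ext _ _ (fun x => Itg setT (fun y => `|ga y|) * `|fa x|)) => //.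
    by apply: intgZ => //; exact: intg_norm.
  by move=> x _; rewrite mulrC.
have := Fubini iK => /= H.
have E1 x : (if a <= x <= b then f x * Itg `[a, x] g else 0) = Itg setT (fun y => K (x, y)).
  have [/andP[ax xb]|nx] := boolP (a <= x <= b); last first.
    rewrite (Itg_ext (g := fun _ => 0)) ?Itg0//.
    move=> y _; rewrite /K /=; case: ifP => // /andP[/andP[ay yx] xb].
    by move: nx; rewrite xb (le_trans ay yx).
  rewrite Itg_if -ItgZ//; last first.
    apply/intg_if; apply: intgS gi => // y /=; rewrite !in_itv /= => /andP[-> yx].
    exact: le_trans xb.
  apply: Itg_ext => y _; rewrite /K /= xb andbT.
  by case: ifP => //; rewrite mulr0.
have E2 y : (if a <= y <= b then g y * Itg `[y, b] f else 0) = Itg setT (fun x => K (x, y)).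
  have [/andP[ay yb]|ny] := boolP (a <= y <= b); last first.
    rewrite (Itg_ext (g := fun _ => 0)) ?Itg0//.
    move=> x _; rewrite /K /=; case: ifP => // /andP[/andP[ay yx] xb].
    by move: ny; rewrite ay (le_trans yx xb).
  rewrite Itg_if -ItgZ//; last first.
    apply/intg_if; apply: intgS fi => // x /=; rewrite !in_itv /= => /andP[yx ->].
    by rewrite (le_trans ay yx).
  apply: Itg_ext => x _; rewrite /K /= ay /=.
  by case: ifP => //; rewrite ?mulr0 // mulrC.
rewrite Itg_if (Itg_ext (fun x _ => E1 x)) Itg_if (Itg_ext (fun x _ => E2 x)).
transitivity (fine (\int[mu]_x \int[mu]_y (K (x, y))%:E)%E); last rewrite H.
  by congr fine; apply: eq_integral => x _; rewrite -EFin_Itg.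
by congr fine; apply: eq_integral => y _; rewrite -EFin_Itg.
Qed.

(** Absolute continuity, encoded by the fundamental theorem of calculus: [f] matters only up to null
    sets and no pointwise derivative of [F] is required, which suits weak derivatives. *)
Definition AC F f : Prop := [/\ measurable_fun setT f,
  forall a b, intg `[a, b] f &
  forall a b, a <= b -> F b - F a = Itg `[a, b] f].

Lemma AC_Itg F f a b : AC F f -> a <= b -> Itg `[a, b] f = F b - F a.
Proof. by move=> [_ _ H] ab; rewrite H. Qed.

Lemma AC_ext F f G g : AC F f -> F =1 G -> f =1 g -> AC G g.
Proof. by move=> H /funext <- /funext <-. Qed.

Lemma AC_le F f a b : AC F f -> a <= b -> `|F b - F a| <= Itg `[a, b] (fun x => `|f x|).
Proof. by move=> [mf fi H] ab; rewrite H//; apply: le_norm_Itg. Qed.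

Lemma AC_bounded F f a b : AC F f -> exists M, forall x, a <= x <= b -> `|F x| <= M.
Proof.
move=> AF; exists (`|F a| + Itg `[a, b] (fun x => `|f x|)) => x /andP[ax xb].
rewrite -[F x](subrK (F a)) addrC (le_trans (ler_normD _ _))// lerD2l.
rewrite (le_trans (AC_le AF ax))//; case: AF => mf fi _.
apply: Itg_subset => //; last exact: intg_norm.
by move=> y /=; rewrite !in_itv /= => /andP[-> yx]; exact: le_trans xb.
Qed.

Lemma AC_continuous F f : AC F f -> continuous F.
Proof.
move=> [mf fi H] x.
have xx : x - 1 <= x + 1 by lra.
have xx' : x - 1 < x + 1 by lra.
have /(continuous_within_itvP _ xx') [c _ _] :=
  @parameterized_integral_continuous R _ _ f xx (fi _ _).
have {}c : {for x, continuous (fun y => parameterized_integral mu (x - 1) y f)}.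
  by apply: c; rewrite in_itv /=; apply/andP; split; lra.
rewrite /continuous_at.
have -> : F x = F (x - 1) + parameterized_integral mu (x - 1) x f.
  rewrite /parameterized_integral -/(Itg _ _) -H ?(addrC (F (x - 1))) ?subrK//; lra.
have : F (x - 1) + parameterized_integral mu (x - 1) y f @[y --> x] -->
   F (x - 1) + parameterized_integral mu (x - 1) x f.
  by apply: cvgD => //; exact: cvg_cst.
apply: cvg_trans; apply: near_eq_cvg; near=> y.
rewrite /parameterized_integral -/(Itg _ _) -H ?(addrC (F (x - 1))) ?subrK//.
near: y; exists 1 => //= y /=; rewrite ltr_norml => /andP[? ?]; lra.
Unshelve. all: by end_near. Qed.

Lemma AC_measurable F f : AC F f -> measurable_fun setT F.
Proof. by move/AC_continuous; exact: continuous_measurable_fun. Qed.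

Lemma AC_loc F f a b : AC F f -> intg `[a, b] F.
Proof.
move=> AF; have [M HM] := AC_bounded a b AF.
by apply: intg_bounded HM; apply: measurable_funTS; exact: AC_measurable AF.
Qed.

Lemma AC_mul_loc F f g a b : AC F f -> intg `[a, b] g -> intg `[a, b] (fun x => g x * F x).
Proof.
move=> AF gi; have [M HM] := AC_bounded a b AF.
apply: (@intg_mul_bounded _ _ _ _ M) => //.
by apply: measurable_funTS; exact: AC_measurable AF.
Qed.

Lemma AC_cst c : AC (fun _ => c) (fun _ => 0).
Proof.
split=> // [a b|a b ab]; first exact: intg_cst.
by rewrite Itg_cst// mul0r subrr.
Qed.

Lemma AC_D F f G g : AC F f -> AC G g -> AC (fun x => F x + G x) (fun x => f x + g x).
Proof.
move=> [mf fi Hf] [mg gi Hg]; split.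
- exact: measurable_funD.
- by move=> a b; exact: intgD.
- by move=> a b ab; rewrite ItgD// -Hf// -Hg//; ring.
Qed.

Lemma AC_Z r F f : AC F f -> AC (fun x => r * F x) (fun x => r * f x).
Proof.
move=> [mf fi Hf]; split.
- exact: measurable_funM.
- by move=> a b; exact: intgZ.
- by move=> a b ab; rewrite ItgZ// -Hf//; ring.
Qed.

(** With inner integrals [G x - G a] and [F b - F x], the triangle identity rearranges to
    [F b * G b - F a * G a]. *)
Lemma AC_M F f G g : AC F f -> AC G g ->
  AC (fun x => F x * G x) (fun x => f x * G x + F x * g x).
Proof.
move=> AF AG; have [mF mG] := (AC_measurable AF, AC_measurable AG).
have [mf fi Hf] := AF; have [mg gi Hg] := AG.
have i1 a b : intg `[a, b] (fun x => f x * G x) by exact: AC_mul_loc AG _.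
have i2 a b : intg `[a, b] (fun x => F x * g x).
  by apply: (intg_ext _ (AC_mul_loc AF (gi a b))) => // x _; rewrite mulrC.
split.
- by apply: measurable_funD; exact: measurable_funM.
- by move=> a b; exact: intgD.
move=> a b ab; rewrite ItgD//.
have := Itg_triangle_swap mf mg (fi a b) (gi a b).
rewrite (Itg_ext (g := fun x => f x * G x - G a * f x)); last first.
  by move=> x /=; rewrite in_itv /= => /andP[ax _]; rewrite -Hg//; ring.
rewrite [RHS](Itg_ext (g := fun x => F b * g x - F x * g x)); last first.
  by move=> x /=; rewrite in_itv /= => /andP[_ xb]; rewrite -Hf//; ring.
rewrite !ItgB//; [|exact: intgZ|exact: intgZ].
rewrite !ItgZ// -Hf// -Hg// => /eqP; rewrite subr_eq => /eqP ->.
ring.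
Qed.

Lemma C1_AC F f : (forall x, is_derive x (1:R) F (f x)) -> continuous f -> AC F f.
Proof.
move=> dF cf.
have dF' x : derivable F x 1 by have [] := dF x.
have mf : measurable_fun setT f by exact: continuous_measurable_fun.
have fi a b : intg `[a, b] f.
  apply: (@continuous_compact_integrable R f `[a, b]); first exact: segment_compact.
  exact: continuous_subspaceT.
split=> // a b; rewrite le_eqVlt => /predU1P[->|ab].
  by rewrite Itg_point subrr.
rewrite /Itg /Rintegral (@continuous_FTC2 _ f F)//.
- exact: continuous_subspaceT.
- have cF : continuous F by move=> x; apply/differentiable_continuous/derivable1_diffP.
  by split => //; [apply: cvg_at_right_filter|apply: cvg_at_left_filter]; exact: cF.
- by move=> x _; rewrite derive1E; have [_ ->] := dF x.
Qed.

Lemma AC_id : AC id (fun _ => 1).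
Proof. by apply: C1_AC => x; exact: cvg_cst. Qed.

Lemma AC_sqr : AC (fun x => x ^+ 2) (fun x => 2 * x).
Proof. by apply: AC_ext (AC_M AC_id AC_id) _ _ => x /=; ring. Qed.

Lemma AC_gauss k : AC (fun x => expR (k * x ^+ 2)) (fun x => 2 * k * x * expR (k * x ^+ 2)).
Proof.
have dq x : is_derive x (1:R) (fun y => k * y ^+ 2) (2 * k * x).
  have : is_derive x (1:R) (k *: ((@id R) * (@id R))) (k *: (x *: 1 + x *: 1)).
    by apply: is_deriveZ; exact: is_deriveM.
  rewrite (_ : k *: _ = (fun y => k * y ^+ 2)); last by apply/funext.
  by move=> H; apply: is_derive_eq H _; rewrite /GRing.scale /=; ring.
apply: C1_AC.
  move=> x; have := @is_derive1_comp R expR _ x _ _ (is_derive_expR _) (dq x).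
  by move=> H; apply: is_derive_eq H _; rewrite mulrC.
have ce : continuous (fun x => expR (k * x ^+ 2)).
  move=> x; apply: (@continuous_comp R R R (fun y => k * y ^+ 2) expR); last exact: continuous_expR.
  by apply/differentiable_continuous/derivable1_diffP; have [] := dq x.
move=> x; apply: cvgM; last exact: ce.
by apply: cvgM; [exact: cvg_cst|exact: cvg_id].
Qed.

Lemma AC_primitive g : measurable_fun setT g -> (forall a b, intg `[a, b] g) ->
  exists G, AC G g.
Proof.
move=> mg gi; exists (fun x => if 0 <= x then Itg `[0, x] g else - Itg `[x, 0] g).
split=> // a b ab.
case: (leP 0 b) => b0; case: (leP 0 a) => a0.
- by rewrite (Itg_chasles a0 ab)//; ring.
- by rewrite opprK (Itg_chasles (ltW a0) b0)//; ring.
- by move: (lt_le_trans b0 (le_trans a0 ab)); rewrite ltxx.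
- by rewrite (Itg_chasles ab (ltW b0))//; ring.
Qed.

End AC.

(** * Energy estimates on the whole line *)

Section WholeLine.
Variable R : realType.
Local Notation mu := (@lebesgue_measure R).
Implicit Types (D : set R) (f g h F G : R -> R) (a b c x y : R).

Lemma cvg_EFin_Itg_sym f : measurable_fun setT f -> (forall x, 0 <= f x) ->
  (forall n, intg `[- n%:R, n%:R] f) ->
  (Itg `[- n%:R, n%:R] f)%:E @[n --> \oo] --> (\int[mu]_x (f x)%:E)%E.
Proof.
move=> mf f0 fi.
rewrite -(@bigcup_itvT R true false).
have : (\int[mu]_(x in `[(- n%:R)%R, n%:R%R]) (f x)%:E)%E @[n --> \oo] -->
    (\int[mu]_(x in \bigcup_n `[(- n%:R)%R, n%:R%R]%classic) (f x)%:E)%E.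
  apply: (@ge0_nondecreasing_set_cvg_integral _ (measurableTypeR R) R
    (fun n : nat => [set` `[- n%:R, n%:R : R]]) (EFin \o f) mu) => //.
  - apply/nondecreasing_seqP => n; rewrite subsetEset => x /=.
    rewrite !in_itv /= -natr1 => /andP[? ?]; by apply/andP; split; lra.
  - by move=> n; apply/measurable_EFinP; exact: measurable_funTS.
  - by move=> n x _; rewrite /= lee_fin.
apply: cvg_trans.
by apply: near_eq_cvg; apply: nearW => n; rewrite EFin_Itg.
Qed.

(** Monotone convergence settles nonnegative functions, and [f] is the difference of [f + |f|] and
    [|f|]. *)
Lemma cvg_Itg_sym f : intg setT f -> Itg `[- n%:R, n%:R] f @[n --> \oo] --> Itg setT f.
Proof.
move=> fi.
have pos g : intg setT g -> (forall x, 0 <= g x) ->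
    Itg `[- n%:R, n%:R] g @[n --> \oo] --> Itg setT g.
  move=> gi g0; apply: (fine_cvg (f := fun n : nat => (Itg `[- n%:R, n%:R] g)%:E)).
  rewrite EFin_Itg//; apply: cvg_EFin_Itg_sym => // [|n]; first exact: intg_mfun gi.
  exact: intgT.
have ai : intg setT (fun x => `|f x|) by exact: intg_norm.
have bi : intg setT (fun x => f x + `|f x|) by exact: intgD.
have <- : Itg setT (fun x => f x + `|f x|) - Itg setT (fun x => `|f x|) = Itg setT f.
  by rewrite ItgD// addrK.
have fp x : 0 <= f x + `|f x| by have := ler_norm (- f x); rewrite normrN; lra.
have -> : (fun n : nat => Itg `[- n%:R, n%:R] f) = (fun n : nat =>
    Itg `[- n%:R, n%:R] (fun x => f x + `|f x|) - Itg `[- n%:R, n%:R] (fun x => `|f x|)).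
  by apply/funext => n; rewrite ItgD ?addrK//; exact: intgT.
by apply: cvgB; exact: pos.
Qed.

Lemma intg_exhaust f C : measurable_fun setT f -> (forall x, 0 <= f x) ->
  (forall n, intg `[- n%:R, n%:R] f) -> (forall n : nat, Itg `[- n%:R, n%:R] f <= C) ->
  intg setT f.
Proof.
move=> mf f0 fi fC; apply/integrableP; split; first exact/measurable_EFinP.
under eq_integral do rewrite gee0_abs ?lee_fin//.
apply: (@le_lt_trans _ _ C%:E); last exact: ltry.
apply: (cvge_to_le (cvg_EFin_Itg_sym mf f0 fi)).
by apply: nearW => n; rewrite lee_fin.
Qed.

(** The integral of [q] over [[-n, n]] is [F n - F (- n)] minus that of [p], hence bounded in [n].
    Since [q >= 0], an upper bound on the boundary term is enough. *)
Lemma AC_nonneg_part F p q C : AC F (fun x => p x + q x) -> intg setT p ->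
  (forall x, 0 <= q x) -> (forall n : nat, F n%:R - F (- n%:R) <= C) -> intg setT q.
Proof.
move=> AF pi q0 FC; have [mf fi _] := AF.
have qE x : p x + q x - p x = q x by rewrite addrC addKr.
have qi a b : intg `[a, b] q.
  by apply: (intg_ext _ (intgB _ (fi a b) (intgT _ pi))) => // x _; rewrite qE.
apply: (@intg_exhaust _ (C + Itg setT (fun x => `|p x|))) => //.
  rewrite (_ : q = fun x => p x + q x - p x); last by apply/funext => x; rewrite qE.
  by apply: measurable_funB => //; exact: intg_mfun pi.
move=> n; have nn : - n%:R <= n%:R :> R by rewrite lerNl (le_trans _ (ler0n _ n))// oppr_le0.
have -> : Itg `[- n%:R, n%:R] q = F n%:R - F (- n%:R) - Itg `[- n%:R, n%:R] p.
  by rewrite -(AC_Itg AF nn) ItgD//; [ring|exact: intgT].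
apply: lerD => //.
have pin : intg `[- n%:R, n%:R] p by exact: intgT.
apply: (le_trans _ (Itg_subset (D' := `[- n%:R, n%:R]) _ _ _ (intg_norm _ pi) _)) => //.
by rewrite (le_trans (ler_norm _))// normrN le_norm_Itg.
Qed.

(** As [F] minus a primitive of [p] is nondecreasing, [F a] is at most [F x] plus the integral of
    [|p|] for every [x] in [[a, a + 1]]; averaging over this interval of length 1 replaces the value
    by an integral. The other end is symmetric. *)
Lemma AC_lower a F p q : AC F (fun x => p x + q x) -> intg setT F -> intg setT p ->
  (forall x, 0 <= q x) ->
  F a <= Itg `[a, a + 1] (fun x => `|F x| + `|p x|) /\
  - F (a + 1) <= Itg `[a, a + 1] (fun x => `|F x| + `|p x|).
Proof.
move=> AF Fi pi q0; have [mf fi _] := AF.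
pose P := Itg `[a, a + 1] (fun x => `|p x|).
have qi c d : intg `[c, d] q.
  apply: (intg_ext _ (intgB _ (fi c d) (intgT _ pi))) => // x _.
  by rewrite addrC addKr.
have H c d : a <= c -> c <= d -> d <= a + 1 -> F c <= F d + P.
  move=> ac cd da; rewrite -lerBlDl -lerN2 opprB -(AC_Itg AF cd).
  rewrite ItgD//; last exact: intgT.
  have h1 : 0 <= Itg `[c, d] q by exact: Itg_ge0.
  have h2 : `|Itg `[c, d] p| <= P.
    apply: (le_trans (le_norm_Itg _ (intgT _ pi))) => //.
    apply: Itg_subset => //; last by apply: intgT => //; exact: intg_norm.
    by move=> x /=; rewrite !in_itv /= => /andP[cx xd]; rewrite (le_trans ac cx) (le_trans xd da).
  by have := ler_norm (- Itg `[c, d] p); rewrite normrN; lra.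
have Fia : intg `[a, a + 1] (fun x => `|F x|) by apply: intgT => //; exact: intg_norm.
have pia : intg `[a, a + 1] (fun x => `|p x|) by apply: intgT => //; exact: intg_norm.
have aa : a <= a + 1 by rewrite lerDl.
have E c : Itg `[a, a + 1] (fun _ => c) = c.
  by rewrite Itg_cst// (addrC a) addrK mulr1.
rewrite ItgD// -/P; split.
- rewrite -lerBlDr -[X in X <= _]E; apply: le_Itg => //; first exact: intg_cst.
  move=> x /=; rewrite in_itv /= => /andP[ax xa].
  by have := H _ _ (lexx a) ax xa; have := ler_norm (F x); lra.
- rewrite -lerBlDr -[X in X <= _]E; apply: le_Itg => //; first exact: intg_cst.
  move=> x /=; rewrite in_itv /= => /andP[ax xa].
  by have := H _ _ ax xa (lexx _); have := ler_norm (- F x); rewrite normrN; lra.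
Qed.

(** Integrability of [F] takes the place of decay at infinity: [F n] is bounded through [[n, n + 1]]
    and [- F (- n)] through [[- n - 1, - n]]. *)
Lemma AC_nonneg_intg F p q : AC F (fun x => p x + q x) -> intg setT F -> intg setT p ->
  (forall x, 0 <= q x) -> intg setT q.
Proof.
move=> AF Fi pi q0.
have mi : intg setT (fun x => `|F x| + `|p x|) by apply: intgD => //; exact: intg_norm.
pose M := Itg setT (fun x => `|F x| + `|p x|).
apply: (AC_nonneg_part AF pi q0 (C := M + M)) => n.
have s a : Itg `[a, a + 1] (fun x => `|F x| + `|p x|) <= M.
  by apply: Itg_subset => // x _; rewrite addr_ge0.
have [h1 _] := AC_lower n%:R AF Fi pi q0.
have [_ h2] := AC_lower (- n%:R - 1) AF Fi pi q0.
rewrite subrK in h1 h2.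
have s2 := s (- n%:R - 1); rewrite subrK in s2.
exact: lerD (le_trans h1 (s _)) (le_trans h2 s2).
Qed.

(** The values of [|F|] at [n] and [- n] are at most the integrals of [|F| + |f|] over the unit
    intervals adjacent to [[-n, n]]. Together these are the increment of a convergent sequence of
    integrals, so the boundary terms vanish in the limit. *)
Lemma AC_Itg_eq0 F f : AC F f -> intg setT F -> intg setT f -> Itg setT f = 0.
Proof.
move=> AF Fi fi.
have AF' : AC F (fun x => f x + 0) by apply: AC_ext AF _ _ => // x; rewrite addr0.
have AN : AC (fun x => -1 * F x) (fun x => -1 * f x + 0).
  by apply: AC_ext (AC_Z (-1) AF) _ _ => // x; rewrite addr0.
pose g x := `|F x| + `|f x|.
have gi : intg setT g by apply: intgD => //; exact: intg_norm.
have b a : `|F a| <= Itg `[a, a + 1] g /\ `|F (a + 1)| <= Itg `[a, a + 1] g.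
  have [h1 h2] := AC_lower a AF' Fi fi (fun _ => lexx 0).
  have [h3 h4] := AC_lower a AN (intgZ (-1) measurableT Fi) (intgZ (-1) measurableT fi) (fun _ => lexx 0).
  have e : Itg `[a, a + 1] (fun x => `|-1 * F x| + `|-1 * f x|) = Itg `[a, a + 1] g.
    by apply: Itg_ext => x _; rewrite !mulN1r !normrN.
  rewrite e !mulN1r in h3 h4; rewrite opprK in h4.
  by rewrite !ler_norml -/g; split; apply/andP; split; rewrite // lerNl.
have c1 := cvg_Itg_sym gi.
have c2 : Itg `[- n.+1%:R, n.+1%:R] g @[n --> \oo] --> Itg setT g by rewrite (cvg_shiftS (fun n => Itg `[- n%:R, n%:R] g)).
have c3 : Itg `[- n.+1%:R, n.+1%:R] g - Itg `[- n%:R, n%:R] g @[n --> \oo] --> (0 : R).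
  by rewrite -(subrr (Itg setT g)); exact: cvgB.
apply: (cvg_unique (@norm_hausdorff _ _) (cvg_Itg_sym fi)).
rewrite /=; apply/norm_cvg0P; apply: (squeeze_cvgr _ (cvg_cst 0) c3).
apply: nearW => n; rewrite normr_ge0 /=.
have nn : - n%:R <= n%:R :> R by rewrite lerNl (le_trans _ (ler0n _ n))// oppr_le0.
rewrite (AC_Itg AF nn) -natr1 opprD.
have i1 : - n%:R - 1 <= - n%:R :> R by rewrite gerBl.
have i2 : n%:R <= n%:R + 1 :> R by rewrite lerDl.
rewrite (@Itg_chasles _ _ (- n%:R)) ?(le_trans nn)//; last exact: intgT.
rewrite (@Itg_chasles _ (- n%:R) n%:R)//; last exact: intgT.
have [h1 _] := b n%:R; have [_ h2] := b (- n%:R - 1); rewrite subrK in h2.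
by have := ler_normB (F n%:R) (F (- n%:R)); lra.
Qed.

Lemma AC_le_Itg F f x : AC F f -> F 0 = 0 -> intg setT f -> `|F x| <= Itg setT (fun y => `|f y|).
Proof.
move=> AF F0 fi; have ni : intg setT (fun y => `|f y|) by exact: intg_norm.
have [x0|x0] := leP 0 x.
  have := AC_le AF x0; rewrite F0 subr0 => /le_trans; apply.
  exact: Itg_subset.
have := AC_le AF (ltW x0); rewrite F0 sub0r normrN => /le_trans; apply.
exact: Itg_subset.
Qed.

(* Energy identity: [(w'/2 + k x w)^2 = w'^2/4 + k^2 x^2 w^2 - (k/2) w^2 + (k/2) (x w^2)'];
   the term [(k/2) w^2] is absorbed by [k^2 x^2 w^2] away from a bounded interval. *)
Lemma first_order_energy (k C : R) (w w' : R -> R) : k != 0 -> AC w w' ->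
  L2r (fun x => w' x / 2 + k * x * w x) ->
  (forall n : nat, - k * (n%:R * w n%:R ^+ 2 + n%:R * w (- n%:R) ^+ 2) <= C) ->
  [/\ L2r w, L2r (fun x => x * w x) & L2r w'].
Proof.
move=> k0 Aw LG wC; have [mG Gi] := LG.
have mw := AC_measurable Aw; have [mw' _ _] := Aw.
have ak : 0 < `|k| by rewrite normr_gt0.
(* For [|x| > r] one has [x^2 >= 1 / |k|], hence [k^2 x^2 >= |k|], and the term [(k/2) w^2] is
   absorbed. *)
pose r := 1 + `|k|^-1.
have A1 : AC (fun x => - (k / 2) * (x * (w x * w x)))
  (fun x => - (k / 2) * (1 * (w x * w x) + x * (w' x * w x + w x * w' x))).
  by apply: AC_Z; apply: AC_M; [exact: AC_id|exact: AC_M].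
have wloc s : intg setT (fun x => if - s <= x <= s then w x ^+ 2 else 0).
  by apply/intg_if; apply: (intg_ext _ (AC_mul_loc Aw (AC_loc _ _ Aw))).
(* The cut-off term is subtracted from [p] and added to [q], which makes [q] nonnegative everywhere
   and cancels in [p + q], the derivative of [- (k/2) x w^2]. *)
pose p x := - (w' x / 2 + k * x * w x) ^+ 2 + - (`|k| / 2) * (if - r <= x <= r then w x ^+ 2 else 0).
pose q x := w' x ^+ 2 / 4 + k ^+ 2 * x ^+ 2 * w x ^+ 2 - k / 2 * w x ^+ 2
   + `|k| / 2 * (if - r <= x <= r then w x ^+ 2 else 0).
have pi : intg setT p.
  by apply: intgD => //; [exact: intgN|exact: intgZ].
have qle x : w' x ^+ 2 / 4 + k ^+ 2 / 2 * (x * w x) ^+ 2 <= q x.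
  have hw := sqr_ge0 (w x).
  rewrite /q exprMn; case: ifPn => hx.
    have h1 : 0 <= k ^+ 2 * (x ^+ 2 * w x ^+ 2).
      by apply: mulr_ge0; [exact: sqr_ge0|apply: mulr_ge0; exact: sqr_ge0].
    have h2 : k * w x ^+ 2 <= `|k| * w x ^+ 2 by apply: ler_wpM2r => //; exact: ler_norm.
    by nra.
  have hr : `|k|^-1 <= x ^+ 2.
    have ik : 0 < `|k|^-1 by rewrite invr_gt0.
    have {hx} : r < `|x|.
      move: hx; rewrite negb_and -!ltNge => /orP[hx|hx].
        by rewrite ltNge ler_norml negb_and -!ltNge hx.
      by rewrite ltNge ler_norml negb_and -!ltNge hx orbT.
    by rewrite -(real_normK (num_real x)) /r => ?; nra.
  have h1 : `|k| <= k ^+ 2 * x ^+ 2.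
    rewrite -(real_normK (num_real k)) -[X in X <= _]mulr1 expr2 -mulrA ler_wpM2l//.
    by rewrite -[X in X <= _](mulfV (lt0r_neq0 ak)) ler_wpM2l.
  have h2 : k * w x ^+ 2 <= k ^+ 2 * x ^+ 2 * w x ^+ 2.
    by apply: ler_wpM2r => //; apply: le_trans h1; exact: ler_norm.
  by rewrite mulr0 addr0; nra.
have q0 x : 0 <= q x.
  apply: le_trans (qle x); apply: addr_ge0; first by rewrite divr_ge0// sqr_ge0.
  by rewrite mulr_ge0 ?sqr_ge0// divr_ge0// sqr_ge0.
have qi : intg setT q.
  apply: (AC_nonneg_part (F := fun x => - (k / 2) * (x * (w x * w x))) (p := p) (C := C / 2)) => //.
    apply: AC_ext A1 _ _ => // x; by rewrite /p /q; field.
  by move=> n; have := wC n; rewrite !expr2; lra.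
have k2 : 0 < k ^+ 2 by rewrite exprn_even_gt0.
have Lxw : L2r (fun x => x * w x).
  apply: (L2r_le _ (intgZ (2 / k ^+ 2) measurableT qi)) => //; first exact: measurable_funM.
  move=> x; rewrite mulrAC ler_pdivlMr//.
  by have := qle x; have := sqr_ge0 (w' x); lra.
split=> //.
- apply: (L2r_le mw (intgD measurableT (proj2 Lxw) (wloc 1))) => // x.
  have hw := sqr_ge0 (w x); rewrite exprMn; case: ifPn => hx.
    by rewrite lerDr mulr_ge0// sqr_ge0.
  rewrite addr0 -[X in X <= _]mul1r ler_wpM2r//.
  have : 1 < `|x|.
    move: hx; rewrite negb_and -!ltNge => /orP[hx|hx].
      by rewrite ltNge ler_norml negb_and -!ltNge hx.
    by rewrite ltNge ler_norml negb_and -!ltNge hx orbT.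
  by rewrite -(real_normK (num_real x)) => ?; nra.
- apply: (L2r_le _ (intgZ 4 measurableT qi)) => // x.
  have := qle x; have := mulr_ge0 (ltW k2) (sqr_ge0 (x * w x)); nra.
Qed.

End WholeLine.

(** * The resolvent at one real point *)

Section Resolvent.
Variable R : realType.
Local Notation mu := (@lebesgue_measure R).
Implicit Types (D : set R) (f g h F G : R -> R) (a b c x y : R).

Lemma Itg_disjoint_le D D' f : measurable D -> measurable D' -> [disjoint D & D'] ->
  intg setT f -> Itg D (fun x => `|f x|) + Itg D' (fun x => `|f x|) <= Itg setT (fun x => `|f x|).
Proof.
move=> mD mD' dD fi; have ni : intg setT (fun x => `|f x|) by exact: intg_norm.
rewrite -[X in X <= _]Rintegral_setU//; last exact: intgT (measurableU _ _ mD mD') ni.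
by apply: Itg_subset => //; exact: measurableU.
Qed.

(** [T x] is the integral of [f] over [[x, +oo[]; because the total integral is 0 it is also minus
    the integral over the left half-line, hence small at both ends. The bound [r n] is the mass of
    [|f|] outside [[-n, n]]; it is stated at [n + 1] to keep the half-lines disjoint from that
    closed interval. *)
Lemma intg_tail f : intg setT f -> Itg setT f = 0 ->
  exists T, exists r : nat -> R, [/\ AC T (fun x => - f x), r n @[n --> \oo] --> (0:R) &
    forall n, `|T n.+1%:R| <= r n /\ `|T (- n.+1%:R)| <= r n].
Proof.
move=> fi f0; have ni : intg setT (fun x => `|f x|) by exact: intg_norm.
exists (fun x => Itg `[x, +oo[ f).
exists (fun n => Itg setT (fun x => `|f x|) - Itg `[- n%:R, n%:R] (fun x => `|f x|)).
split.
- split=> [|a b|a b ab].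
  + by apply: measurableT_comp => //; exact: intg_mfun fi.
  + by apply: intgN => //; exact: intgT.
  + rewrite ItgN//; last exact: intgT.
    have := @Rintegral_itvB R f (BLeft a) +oo%O b (intgT _ fi).
    rewrite !bnd_simp => /(_ _ ab isT) H.
    rewrite /Itg -(@Rintegral_itv_obnd_cbnd _ b); last exact: intgT.
    by rewrite -H//; ring.
- rewrite -(subrr (Itg setT (fun x => `|f x|))); apply: cvgB; first exact: cvg_cst.
  exact: cvg_Itg_sym.
- move=> n.
  have half D : measurable D -> [disjoint D & `[- n%:R, n%:R]%classic] ->
     `|Itg D f| <= Itg setT (fun x => `|f x|) - Itg `[- n%:R, n%:R] (fun x => `|f x|).
    move=> mD dD; apply: (le_trans (le_norm_Itg mD (intgT _ fi))) => //.
    by rewrite lerBrDr Itg_disjoint_le.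
  have nS : n%:R < n.+1%:R :> R by rewrite ltr_nat.
  split.
    apply: half => //; apply/disj_setPS => x [] /=; rewrite !in_itv /= andbT => h1 /andP[_ h2].
    by have := lt_le_trans nS (le_trans h1 h2); rewrite ltxx.
  have -> : Itg `[- n.+1%:R, +oo[ f = - Itg `]-oo, - n.+1%:R[ f.
    apply/eqP; rewrite -subr_eq0 opprK addrC -f0 eq_sym; apply/eqP.
    rewrite -[RHS]Rintegral_setU//; last 2 first.
    - by apply: intgT => //; exact: measurableU.
    - apply/disj_setPS => x [] /=; rewrite !in_itv /= andbT => h1 h2.
      by have := lt_le_trans h1 h2; rewrite ltxx.
    rewrite /Itg; congr Rintegral; apply/seteqP; split => x //= _.
    by rewrite !in_itv /= andbT; case: (ltP x (- n.+1%:R)); [left|right].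
  rewrite normrN; apply: half => //; apply/disj_setPS => x [] /=; rewrite !in_itv /= => h1 /andP[h2 _].
  by have := lt_le_trans h1 (le_trans _ h2); rewrite lerN2 ltW// ltxx => /(_ isT).
Qed.

Lemma le_of_cvg0 (u : nat -> R) c d : u n @[n --> \oo] --> (0 : R) ->
  (exists N, forall n, (N <= n)%N -> d <= u n + c) -> d <= c.
Proof.
move=> u0 [N H].
have u1 : u n + c @[n --> \oo] --> c by rewrite -[X in _ --> X]add0r; apply: cvgD => //; exact: cvg_cst.
apply: (cvgr_to_ge u1); exists N => // n /=; exact: H.
Qed.

Lemma gauss_cancel k x : expR (k * x ^+ 2) * expR (- k * x ^+ 2) = 1.
Proof. by rewrite -expRD mulNr subrr expR0. Qed.

(** The equation is [v'/2 + k x v = g]. Multiplied by [2 exp (k x^2)], it says that [exp (k x^2) v]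
    is a primitive of [2 g exp (k x^2)]. *)
Lemma AC_first_order_solution k g : L2r g -> exists v, AC v (fun x => 2 * (g x - k * x * v x)).
Proof.
move=> Lg.
have gi a b : intg `[a, b] (fun x => 2 * (g x * expR (k * x ^+ 2))).
  apply: intgZ => //; exact: AC_mul_loc (AC_gauss k) (L2r_loc a b Lg).
have mg : measurable_fun setT (fun x => 2 * (g x * expR (k * x ^+ 2))).
  apply: measurable_funM => //; apply: measurable_funM; first by case: Lg.
  exact: AC_measurable (AC_gauss k).
have [G AG] := AC_primitive mg gi.
exists (fun x => expR (- k * x ^+ 2) * G x).
apply: AC_ext (AC_M (AC_gauss (- k)) AG) _ _ => // x.
rewrite [X in _ + X](_ : _ = 2 * g x * (expR (k * x ^+ 2) * expR (- k * x ^+ 2))); last by ring.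
rewrite gauss_cancel; ring.
Qed.

(** For [k > 0] the boundary term of the energy identity has the favourable sign, so every solution
    is square integrable, whatever its constant of integration. *)
Lemma first_order_decay k v g : 0 < k -> AC v (fun x => 2 * (g x - k * x * v x)) -> L2r g ->
  [/\ L2r v, L2r (fun x => x * v x) & L2r (fun x => 2 * (g x - k * x * v x))].
Proof.
move=> k0 Av Lg; apply: (first_order_energy (k := k) (C := 0)) => //.
- by rewrite gt_eqF.
- by rewrite (_ : (fun x => _) = g) => //; apply/funext => x; field.
- by move=> n; rewrite mulNr oppr_le0 mulr_ge0 ?(ltW k0)// addr_ge0// mulr_ge0// sqr_ge0.
Qed.

(** The Gaussian solves the first-order equation with right-hand side 0, so its square integrability
    comes from the energy estimate and no Gaussian integral is computed. *)
Lemma gauss_decay k : 0 < k -> [/\ L2r (fun x => expR (- k * x ^+ 2)),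
  L2r (fun x => x * expR (- k * x ^+ 2)) & AC (fun x => expR (- k * x ^+ 2))
   (fun x => 2 * (0 - k * x * expR (- k * x ^+ 2)))].
Proof.
move=> k0; have A : AC (fun x => expR (- k * x ^+ 2)) (fun x => 2 * (0 - k * x * expR (- k * x ^+ 2))).
  by apply: AC_ext (AC_gauss (- k)) _ _ => // x; ring.
by have [] := first_order_decay k0 A (L2r_cst0 R).
Qed.

Lemma pos_Itg f c : intg setT f -> (forall x, 0 <= f x) -> 0 < c ->
  (forall x, 0 <= x <= 1 -> c <= f x) -> 0 < Itg setT f.
Proof.
move=> fi f0 c0 fc; apply: (lt_le_trans c0).
apply: (@le_trans _ _ (Itg `[0, 1] f)); last exact: Itg_subset.
have -> : c = Itg `[0, 1] (fun _ => c) by rewrite Itg_cst// subr0 mulr1.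
by apply: le_Itg => //; [exact: intg_cst|exact: intgT].
Qed.

(** Boundedness of [x v^2] gives [|v y| <= K |y|] for [|y| >= x], with [K = sqrt (M / x) / x]. The
    factor [|y|] is inserted on purpose: [y exp (- b y^2)] has an explicit primitive. The far end of
    the integral is removed by [r n --> 0]. *)
Lemma gauss_tail_bound b M v T (r : nat -> R) : 0 < b ->
  (forall x, `|x * v x ^+ 2| <= M) ->
  AC T (fun x => - (expR (- b * x ^+ 2) * v x)) -> r n @[n --> \oo] --> (0 : R) ->
  (forall n, `|T n.+1%:R| <= r n /\ `|T (- n.+1%:R)| <= r n) ->
  forall n, let x : R := n.+1%:R in
  `|T x| <= Num.sqrt (M / x) / x * (expR (- b * x ^+ 2) / (2 * b)) /\
  `|T (- x)| <= Num.sqrt (M / x) / x * (expR (- b * x ^+ 2) / (2 * b)).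
Proof.
move=> b0 vM AT r0 Tr n x.
have x0 : 0 < x by rewrite ltr0n.
have M0 : 0 <= M by apply: le_trans (vM 0); exact: normr_ge0.
set K := Num.sqrt (M / x) / x.
have K0 : 0 <= K by rewrite divr_ge0 ?sqrtr_ge0// ltW.
have vK y : x <= `|y| -> `|v y| <= K * `|y|.
  move=> xy; have y0 : 0 < `|y| := lt_le_trans x0 xy.
  have h1 : `|v y| <= Num.sqrt (M / x).
    rewrite -ler_sqr ?nnegrE ?sqrtr_ge0// sqr_sqrtr ?divr_ge0 ?(ltW x0)//.
    rewrite ler_pdivlMr// real_normK ?num_real//; apply: le_trans (vM y).
    by rewrite normrM [`|v y ^+ 2|]ger0_norm ?sqr_ge0// mulrC ler_wpM2r// sqr_ge0.
  by rewrite /K mulrAC ler_pdivlMr// ler_pM// ltW.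
have AE : AC (fun y => (2 * b)^-1 * expR (- b * y ^+ 2)) (fun y => - (y * expR (- b * y ^+ 2))).
  have [_ _ A] := gauss_decay b0; apply: AC_ext (AC_Z (2 * b)^-1 A) _ _ => // y.
  by field; rewrite gt_eqF.
have e0 y : 0 <= expR (- b * y ^+ 2) by rewrite expR_ge0.
have iv c d : intg `[c, d] (fun y => `|- (expR (- b * y ^+ 2) * v y)|).
  by apply: intg_norm => //; case: AT.
have ie c d : intg `[c, d] (fun y => - (y * expR (- b * y ^+ 2))) by case: AE.
have pos N : (n <= N)%N -> `|T x| <= r N + K * (expR (- b * x ^+ 2) / (2 * b)).
  move=> nN; have xN : x <= N.+1%:R by rewrite ler_nat ltnS.
  have h : `|T N.+1%:R - T x| <= K * (expR (- b * x ^+ 2) / (2 * b)).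
    apply: (le_trans (AC_le AT xN)).
    apply: (@le_trans _ _ (Itg `[x, N.+1%:R] (fun y => - K * - (y * expR (- b * y ^+ 2))))).
      apply: le_Itg => //; first exact: intgZ.
      move=> y /=; rewrite in_itv /= => /andP[xy _]; have y0 : 0 <= y by apply: le_trans xy; exact: ltW.
      rewrite normrN normrM (ger0_norm (e0 y)) mulrNN [K * _]mulrA [_ * `|v y|]mulrC ler_wpM2r//.
      by rewrite -[in X in _ <= X](ger0_norm y0) vK// ger0_norm.
    rewrite ItgZ// (AC_Itg AE xN).
    have : 0 <= K * ((2 * b)^-1 * expR (- b * N.+1%:R ^+ 2)).
      by rewrite mulr_ge0// mulr_ge0// invr_ge0 mulr_ge0// ltW.
    lra.
  by have [h1 _] := Tr N; have := ler_distD (T N.+1%:R) (T x) 0; rewrite !subr0 distrC; lra.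
have neg N : (n <= N)%N -> `|T (- x)| <= r N + K * (expR (- b * x ^+ 2) / (2 * b)).
  move=> nN; have xN : - N.+1%:R <= - x by rewrite lerN2 ler_nat ltnS.
  have h : `|T (- x) - T (- N.+1%:R)| <= K * (expR (- b * x ^+ 2) / (2 * b)).
    apply: (le_trans (AC_le AT xN)).
    apply: (@le_trans _ _ (Itg `[- N.+1%:R, - x] (fun y => K * - (y * expR (- b * y ^+ 2))))).
      apply: le_Itg => //; first exact: intgZ.
      move=> y /=; rewrite in_itv /= => /andP[_ yx].
      have y0 : y <= 0 by apply: (le_trans yx); rewrite oppr_le0 ltW.
      rewrite normrN normrM (ger0_norm (e0 y)) -mulNr [K * _]mulrA [_ * `|v y|]mulrC ler_wpM2r//.
      by rewrite -[in X in _ <= X](ler0_norm y0) vK// ler0_norm// lerNr.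
    rewrite ItgZ// (AC_Itg AE xN) sqrrN.
    have : 0 <= K * ((2 * b)^-1 * expR (- b * (- N.+1%:R) ^+ 2)).
      by rewrite mulr_ge0// mulr_ge0// invr_ge0 mulr_ge0// ltW.
    lra.
  by have [_ h1] := Tr N; have := ler_distD (T (- N.+1%:R)) (T (- x)) 0; rewrite !subr0; lra.
by split; apply: (le_of_cvg0 r0); exists n => N; [exact: pos|exact: neg].
Qed.

(** The derivatives [p1] and [p2] are carried along as data. Square integrability of [x * p1 x] is
    not demanded; it is derived in [Dom_xp1]. *)
Definition Dom p p1 p2 : Prop := [/\ AC p p1, AC p1 p2 &
  [/\ L2r p, L2r p1, L2r p2 & L2r (fun x => x ^+ 2 * p x)]].

Definition Hop gamma p p1 p2 x : R :=
  - (p2 x / 4) + x ^+ 2 * p x - gamma * (p x / 2 + x * p1 x).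

(* [H + s/2 = (d/2 + a x)(- d/2 + b x)] with [s = sqrt (1 + gamma^2)], [a = s + gamma], [b = s - gamma]. *)
Lemma resolvent_base gamma g : L2r g -> exists p p1 p2, Dom p p1 p2 /\
  forall x, Hop gamma p p1 p2 x + Num.sqrt (1 + gamma ^+ 2) / 2 * p x = g x.
Proof.
move=> Lg; set s := Num.sqrt _.
have s2 : s ^+ 2 = 1 + gamma ^+ 2 by rewrite sqr_sqrtr// addr_ge0// sqr_ge0.
have s0 : 0 <= s by rewrite sqrtr_ge0.
have [a0 b0] : 0 < s + gamma /\ 0 < s - gamma by split; nra.
set a := s + gamma in a0 *; set b := s - gamma in b0 *.
have ab : a * b = 1 by rewrite /a /b; move: s2; nra.
have [v0 Av0] := AC_first_order_solution a Lg.
have [Lv0 _ _] := first_order_decay a0 Av0 Lg.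
have [Lea _ Aea] := gauss_decay a0.
have [Leb _ Aeb] := gauss_decay b0.
have Li0 := L2r_mul Leb Lv0; have Li1 := L2r_mul Leb Lea.
set M0 := Itg setT (fun x => expR (- b * x ^+ 2) * v0 x).
set M1 := Itg setT (fun x => expR (- b * x ^+ 2) * expR (- a * x ^+ 2)).
have M10 : 0 < M1.
  apply: (pos_Itg (c := expR (- (a + b)))) => //.
  - exact: expR_gt0.
  - move=> x /andP[x0 x1]; rewrite -expRD ler_expR.
    have : x ^+ 2 <= 1 by rewrite expr_le1.
    by have := sqr_ge0 x; nra.
pose v x := v0 x + - (M0 / M1) * expR (- a * x ^+ 2).
have Av : AC v (fun x => 2 * (g x - a * x * v x)).
  by apply: AC_ext (AC_D Av0 (AC_Z (- (M0 / M1)) Aea)) _ _ => // x; rewrite /v; ring.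
have [Lv Lxv Lv'] := first_order_decay a0 Av Lg.
have fi := L2r_mul Leb Lv.
(* This orthogonality lets the solution of the second equation decay at both ends. *)
have f0 : Itg setT (fun x => expR (- b * x ^+ 2) * v x) = 0.
  rewrite (Itg_ext (g := fun x => expR (- b * x ^+ 2) * v0 x +
    - (M0 / M1) * (expR (- b * x ^+ 2) * expR (- a * x ^+ 2)))); last by move=> x _; rewrite /v; ring.
  rewrite ItgD//; last exact: intgZ.
  by rewrite ItgZ// -/M0 -/M1; field; rewrite gt_eqF.
have [T [r [AT r0 Tr]]] := intg_tail fi f0.
(* [x v^2] vanishes at 0 and its derivative [v^2 + 2 x v v'] is integrable, hence it is bounded. *)
have [M vM] : exists M, forall x, `|x * v x ^+ 2| <= M.
  have A := AC_M (@AC_id R) (AC_M Av Av).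
  have I : intg setT (fun x => 1 * (v x * v x) + id x *
      (2 * (g x - a * x * v x) * v x + v x * (2 * (g x - a * x * v x)))).
    have := intgD measurableT (proj2 Lv) (intgZ 2 measurableT (L2r_mul Lxv Lv')).
    by move/intg_ext; apply => // x _; ring.
  exists (Itg setT (fun x => `|1 * (v x * v x) + id x *
      (2 * (g x - a * x * v x) * v x + v x * (2 * (g x - a * x * v x)))|)) => x.
  by rewrite expr2; apply: (AC_le_Itg x A _ I); rewrite mul0r.
have bound := gauss_tail_bound b0 vM AT r0 Tr.
(* The solution of [- u'/2 + b x u = v] given by the integral of [exp (- b y^2) v y] from [x] to
   infinity. *)
pose u x := 2 * (expR (b * x ^+ 2) * T x).
have Mge0 : 0 <= M by apply: le_trans (vM 0); exact: normr_ge0.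
(* The cube is there because the energy estimate is also applied to [x u], whose boundary term is
   [x (x u)^2]. For [u] itself, [x u^2] is smaller since [x >= 1]. *)
have ub n : let x : R := n.+1%:R in x ^+ 3 * u x ^+ 2 <= M / b ^+ 2 /\ x ^+ 3 * u (- x) ^+ 2 <= M / b ^+ 2.
  move=> x; have x0 : 0 < x by rewrite ltr0n.
  have H y : y ^+ 2 = x ^+ 2 -> `|T y| <= Num.sqrt (M / x) / x * (expR (- b * x ^+ 2) / (2 * b)) ->
      x ^+ 3 * u y ^+ 2 <= M / b ^+ 2.
    move=> yx Ty.
    have h : `|u y| <= Num.sqrt (M / x) / (x * b).
      rewrite /u normrM ger0_norm// normrM ger0_norm ?expR_ge0// yx.
      apply: (@le_trans _ _ (2 * (expR (b * x ^+ 2) * (Num.sqrt (M / x) / x * (expR (- b * x ^+ 2) / (2 * b)))))).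
        by rewrite ler_wpM2l// ler_wpM2l// expR_ge0.
      rewrite [X in X <= _](_ : _ = expR (b * x ^+ 2) * expR (- b * x ^+ 2) * (Num.sqrt (M / x) / (x * b))).
        by rewrite gauss_cancel mul1r.
      by field; rewrite !gt_eqF.
    have h2 : u y ^+ 2 <= (M / x) / (x * b) ^+ 2.
      rewrite -(real_normK (num_real (u y))) -[X in X / _](@sqr_sqrtr _ (M / x)) ?divr_ge0 ?(ltW x0)//.
      by rewrite -expr_div_n ler_sqr// nnegrE divr_ge0 ?sqrtr_ge0// ltW// mulr_gt0.
    rewrite (_ : M / b ^+ 2 = x ^+ 3 * (M / x / (x * b) ^+ 2)); last by field; rewrite !gt_eqF.
    by rewrite ler_wpM2l// exprn_ge0// ltW.
  by have [h1 h2] := bound n; split; apply: H => //; rewrite sqrrN.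
have Au : AC u (fun x => 2 * (b * x * u x - v x)).
  apply: AC_ext (AC_Z 2 (AC_M (AC_gauss b) AT)) _ _ => // x.
  rewrite /u; have := gauss_cancel b x; set e1 := expR _; set e2 := expR _ => e12.
  rewrite [LHS](_ : _ = 2 * (b * x * (2 * (e1 * T x)) - (e1 * e2) * v x)); last by ring.
  by rewrite e12 mul1r.
have [Lu Lxu Lu'] : [/\ L2r u, L2r (fun x => x * u x) & L2r (fun x => 2 * (b * x * u x - v x))].
  apply: (first_order_energy (k := - b) (C := b * (M / b ^+ 2 + M / b ^+ 2))) => //.
  - by rewrite oppr_eq0 gt_eqF.
  - by rewrite (_ : (fun x => _) = (fun x => - v x)); [exact: L2rN|apply/funext => x; field].
  - have c0 : 0 <= M / b ^+ 2 by rewrite divr_ge0// sqr_ge0.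
    case=> [|n]; first by rewrite !mul0r addr0 mulr0 mulr_ge0 ?(ltW b0)// addr_ge0.
    have [h1 h2] := ub n; rewrite opprK ler_wpM2l ?(ltW b0)//.
    have x1 : 1 <= n.+1%:R ^+ 2 :> R by rewrite exprn_ege1// ler1n.
    have aux y : 0 <= y -> n.+1%:R * y <= n.+1%:R ^+ 3 * y.
      by move=> y0; rewrite ler_wpM2r// exprS ler_peMr.
    by apply: lerD; [apply: le_trans h1|apply: le_trans h2]; apply: aux; exact: sqr_ge0.
(* [x u] solves an equation of the same kind, with right-hand side [u/2 - x v] already known to be
   in [L^2]. This yields both [x^2 u] and [(x u)'] in [L^2], the latter being what
   [u'' = 2 (b (x u)' - v')] requires. *)
have Axu : AC (fun x => x * u x) (fun x => u x + x * (2 * (b * x * u x - v x))).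
  by apply: AC_ext (AC_M (@AC_id R) Au) _ _ => // x /=; rewrite mul1r.
have [_ Lxxu Lxu'] : [/\ L2r (fun x => x * u x), L2r (fun x => x * (x * u x)) &
    L2r (fun x => u x + x * (2 * (b * x * u x - v x)))].
  apply: (first_order_energy (k := - b) (C := b * (M / b ^+ 2 + M / b ^+ 2))) => //.
  - by rewrite oppr_eq0 gt_eqF.
  - by apply: (L2r_ext (L2rB (L2rZ 2^-1 Lu) Lxv)) => x; field.
  - have c0 : 0 <= M / b ^+ 2 by rewrite divr_ge0// sqr_ge0.
    case=> [|n]; first by rewrite !mul0r addr0 mulr0 mulr_ge0 ?(ltW b0)// addr_ge0.
    have [h1 h2] := ub n; rewrite opprK ler_wpM2l ?(ltW b0)//.
    have e1 (z y : R) : z * (z * y) ^+ 2 = z ^+ 3 * y ^+ 2 by ring.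
    have e2 (z y : R) : z * (- z * y) ^+ 2 = z ^+ 3 * y ^+ 2 by ring.
    by rewrite e1 e2 lerD.
exists u, (fun x => 2 * (b * x * u x - v x)),
  (fun x => 2 * (b * (u x + x * (2 * (b * x * u x - v x))) - 2 * (g x - a * x * v x))).
split; last first.
  move=> x; rewrite /Hop /a.
  have -> : gamma = (a - b) / 2 by rewrite /a /b; field.
  have -> : s = (a + b) / 2 by rewrite /a /b; field.
  have : a * b * (x ^+ 2 * u x) = x ^+ 2 * u x by rewrite ab mul1r.
  by move: (u x) (v x) (g x) => U V W; lra.
split=> //.
- apply: AC_ext (AC_Z 2 (AC_D (AC_Z b Axu) (AC_Z (-1) Av))) _ _ => // x /=; ring.
- split=> //; first by apply/L2rZ/L2rB => //; exact: L2rZ.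
  by apply: (L2r_ext Lxxu) => x; ring.
Qed.

End Resolvent.

(** * A smooth bump function *)

Section Smooth.
Variable R : realType.
Implicit Types (f g h : R -> R) (a b c x y : R).

(** Derivatives are only asserted to exist, level by level, so smoothness propagates through sums,
    products and affine changes without any formula for higher derivatives. *)
Fixpoint Ck k f : Prop :=
  if k is k'.+1 then exists2 f', (forall x, is_derive x (1:R) f (f' x)) & Ck k' f' else True.

Lemma is_derive_derive1 f f' : (forall x, is_derive x (1:R) f (f' x)) -> derive1 f = f'.
Proof. by move=> df; apply/funext => x; rewrite derive1E; have [_ ->] := df x. Qed.

Lemma Ck_test f : (forall k, Ck k f) -> forall n x, derivable (derive1n n f) x 1.
Proof.
move=> Cf n x.
suff H : forall n k, Ck k (derive1n n f) by have [f' df _] := H n 1%N; have [] := df x.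
elim=> [|m IH] k; first exact: Cf.
by have [f' df Cf'] := IH k.+1; rewrite derive1nS (is_derive_derive1 df).
Qed.

Lemma Ck_pred k f : Ck k.+1 f -> Ck k f.
Proof. by elim: k f => // k IH f [f' df Cf']; exists f' => //; exact: IH. Qed.

Lemma CkD k f g : Ck k f -> Ck k g -> Ck k (fun x => f x + g x).
Proof.
elim: k f g => // k IH f g [f' df Cf] [g' dg Cg].
by exists (fun x => f' x + g' x); [move=> x; exact: is_deriveD|exact: IH].
Qed.

Lemma CkZ k c f : Ck k f -> Ck k (fun x => c * f x).
Proof.
elim: k f => // k IH f [f' df Cf].
by exists (fun x => c * f' x); [move=> x; exact: (is_deriveZ c (df x))|exact: IH].
Qed.

Lemma CkM k f g : Ck k f -> Ck k g -> Ck k (fun x => f x * g x).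
Proof.
elim: k f g => // k IH f g Cf Cg.
have [f' df Cf'] := Cf; have [g' dg Cg'] := Cg.
exists (fun x => f' x * g x + f x * g' x).
  move=> x; apply: is_derive_eq (is_deriveM (df x) (dg x)) _.
  by rewrite /GRing.scale /=; ring.
by apply: CkD; apply: IH => //; exact: Ck_pred.
Qed.

Lemma is_derive_affine c d f l x : is_derive (c * x + d) (1:R) f l ->
  is_derive x (1:R) (fun y => f (c * y + d)) (c * l).
Proof.
move=> df.
have dg : is_derive x (1:R) (fun y => c * y + d) c.
  have := is_deriveD (is_deriveZ c (is_derive_id x (1:R))) (is_derive_cst d x (1:R)).
  by move=> H; apply: is_derive_eq H _; rewrite /GRing.scale /=; ring.
by rewrite mulrC; exact: (@is_derive1_comp R f _ x l c df dg).
Qed.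

Lemma Ck_affine k c d f : Ck k f -> Ck k (fun x => f (c * x + d)).
Proof.
elim: k f => // k IH f [f' df Cf].
exists (fun x => c * f' (c * x + d)); first by move=> x; exact: is_derive_affine.
exact/CkZ/IH.
Qed.

Lemma is_derive_quadratic f c : (forall h : R, `|f h| <= c * h ^+ 2) -> is_derive 0 (1:R) f 0.
Proof.
move=> fc.
have f0 : f 0 = 0 by apply/eqP; rewrite -normr_le0; have := fc 0; rewrite expr0n mulr0.
have H : h^-1 *: ((f \o shift 0) (h *: 1) - f 0) @[h --> 0^'] --> (0 : R).
  apply/norm_cvg0P.
  have c0 : c * `|h| @[h --> (0:R)^'] --> (0 : R).
    rewrite -[X in _ --> X](mulr0 c); apply: cvgMr.
    rewrite -[X in _ --> X](normr0 R); apply: cvg_norm; exact: cvg_within.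
  apply: (squeeze_cvgr _ (cvg_cst 0) c0); near=> h.
  have h0 : h != 0 by near: h; exact: nbhs_dnbhs_neq.
  rewrite normr_ge0 /= f0 subr0 addr0 /GRing.scale /= mulr1 normrM normfV.
  rewrite mulrC ler_pdivrMr ?normr_gt0// -mulrA -expr2 real_normK ?num_real//; exact: fc.
by apply: DeriveDef; [apply/cvg_ex; exists 0|exact: cvg_lim].
Unshelve. all: by end_near. Qed.

(** [n = 0] is the classical smooth non-analytic function [exp (- 1/x)]. The powers of [1/x] are
    included so that the family is stable under differentiation, up to linear combinations. *)
Definition flat n x : R := if 0 < x then x^-1 ^+ n * expR (- x^-1) else 0.

Lemma flat_ge0 n x : 0 <= flat n x.
Proof.
by rewrite /flat; case: ifP => // x0; rewrite mulr_ge0 ?expR_ge0// exprn_ge0// invr_ge0 ltW.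
Qed.

(** With [t = 1/x], the exponential series gives [exp t >= t^(n+2) / (n+2)!]. A quadratic bound is
    what forces the derivative at 0 to vanish. *)
Lemma flat_quadratic n x : `|flat n x| <= (n.+2)`!%:R * x ^+ 2.
Proof.
rewrite ger0_norm ?flat_ge0// /flat; case: ifP => x0; last by rewrite mulr_ge0 ?sqr_ge0.
have t0 : 0 < x^-1 by rewrite invr_gt0.
have := expR_ge1Dxn n.+1 (ltW t0); set t := x^-1 in t0 * => H.
have f0 : 0 < (n.+2)`!%:R :> R by rewrite ltr0n fact_gt0.
have -> : x ^+ 2 = t ^- 2 by rewrite /t exprVn invrK.
rewrite expRN ler_pdivlMr ?exprn_gt0// mulrAC ler_pdivrMr ?expR_gt0//.
rewrite -exprD addn2 mulrC -ler_pdivrMr//; lra.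
Qed.

Lemma is_derive_flat n x : is_derive x (1:R) (flat n) (flat n.+2 x - n%:R * flat n.+1 x).
Proof.
have [x0|x0|->] := ltgtP x 0.
- rewrite /flat !ltNge (ltW x0) /= mulr0 subr0.
  apply: near_eq_is_derive (is_derive_cst 0 x 1).
  near=> y; rewrite /= ltNge ifF//; apply/negbTE; rewrite negbK ltW//.
  by near: y; exact: lt_nbhsl.
- rewrite /flat x0.
  have t0 : x^-1 != 0 by rewrite invr_eq0 gt_eqF.
  have d1 := is_deriveV (lt0r_neq0 x0 : id x != 0) (is_derive_id x (1:R)).
  have d2 : is_derive x^-1 (1:R) (fun t => ('X^n : {poly R}).[t] * expR (- t))
      (('X^n : {poly R})^`().[x^-1] * expR (- x^-1) - (x^-1) ^+ n * expR (- x^-1)).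
    have e := is_derive1_comp (is_derive_expR (- x^-1)) (is_deriveNid x^-1 (1:R)).
    have := is_deriveM (is_derive_poly ('X^n) x^-1) e.
    move=> H; apply: is_derive_eq H _.
    by rewrite /GRing.scale /= hornerXn; ring.
  have d3 := is_derive1_comp d2 d1.
  apply: (@near_eq_is_derive _ _ _ ((fun t => ('X^n : {poly R}).[t] * expR (- t)) \o (fun y => (id y)^-1))).
    near=> y; rewrite /= hornerXn ifT//; near: y; exact: lt_nbhsr.
  apply: is_derive_eq d3 _; rewrite derivXn hornerMn hornerXn /GRing.scale /= mulr1.
  rewrite -exprVn; set t := x^-1; case: n {d2} => [|n] /=; first by rewrite !mulr0n; ring.
  by rewrite -mulr_natr !exprS; ring.
- rewrite /flat ltxx mulr0 subr0; exact: is_derive_quadratic (flat_quadratic n).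
Unshelve. all: by end_near. Qed.

Lemma Ck_flat k n : Ck k (flat n).
Proof.
elim: k n => // k IH n; exists (fun x => flat n.+2 x - n%:R * flat n.+1 x).
  exact: is_derive_flat.
rewrite (_ : (fun x => _) = (fun x => flat n.+2 x + - n%:R * flat n.+1 x)); last first.
  by apply/funext => x; rewrite mulNr.
by apply: CkD => //; exact: CkZ.
Qed.

Definition smooth_bump x : R := flat 0 x * flat 0 (-1 * x + 1).

Lemma Ck_bump k : Ck k smooth_bump.
Proof. by apply: CkM; [|apply: Ck_affine]; exact: Ck_flat. Qed.

Lemma smooth_bump_ge0 x : 0 <= smooth_bump x.
Proof. by rewrite mulr_ge0// flat_ge0. Qed.

Lemma smooth_bump_le1 x : smooth_bump x <= 1.
Proof.
have H y : flat 0 y <= 1.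
  rewrite /flat; case: ifP => y0; last exact: ler01.
  by rewrite expr0 mul1r -expR0 ler_expR oppr_le0 invr_ge0 ltW.
by rewrite mulr_ile1// ?flat_ge0.
Qed.

Lemma smooth_bump_supp x : ~~ (0 <= x <= 1) -> smooth_bump x = 0.
Proof.
rewrite negb_and -!ltNge /smooth_bump /flat => /orP[x0|x1].
  by rewrite ltNge (ltW x0) mul0r.
by rewrite [X in _ * X]ifF ?mulr0//; apply/negbTE; rewrite -leNgt; lra.
Qed.

Lemma smooth_bump_continuous : continuous smooth_bump.
Proof.
move=> x; have [f' df _] := Ck_bump 1.
by apply/differentiable_continuous/derivable1_diffP; have [] := df x.
Qed.

Lemma intg_support f a b : intg `[a, b] f -> (forall x, ~~ (a <= x <= b) -> f x = 0) -> intg setT f.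
Proof.
move=> /intg_if fi fs; apply: (intg_ext _ fi) => // x _.
by case: ifPn => // /fs ->.
Qed.

Lemma Itg_support f a b : (forall x, ~~ (a <= x <= b) -> f x = 0) -> Itg setT f = Itg `[a, b] f.
Proof. by move=> fs; rewrite Itg_if; apply: Itg_ext => x _; case: ifPn => // /fs ->. Qed.

Lemma intg_bump : intg setT smooth_bump.
Proof.
apply: (@intg_support _ 0 1); last exact: smooth_bump_supp.
apply: (@intg_bounded _ _ _ _ 1).
  by apply: measurable_funTS; exact: continuous_measurable_fun smooth_bump_continuous.
by move=> x _; rewrite ger0_norm ?smooth_bump_ge0 ?smooth_bump_le1.
Qed.

Lemma Itg_bump_gt0 : 0 < Itg setT smooth_bump.
Proof.
(* On [[1/4, 3/4]] both [x] and [1 - x] are at least [1/4], so each factor of the bump is at least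
   [exp (- 4)]. *)
pose e := expR (- 4) * expR (- 4) : R.
have e0 : 0 < e by rewrite mulr_gt0// expR_gt0.
apply: (@lt_le_trans _ _ (Itg `[4^-1, 3 / 4] (fun _ => e))).
  by rewrite Itg_cst; [rewrite mulr_gt0//; lra|lra].
apply: (@le_trans _ _ (Itg `[4^-1, 3 / 4] smooth_bump)).
  apply: le_Itg => //; [exact: intg_cst|exact: intgT intg_bump|].
  have F y : 4^-1 <= y -> expR (- 4) <= flat 0 y.
    move=> y4; have y0 : 0 < y by lra.
    by rewrite /flat y0 expr0 mul1r ler_expR lerN2 -[X in _ <= X]invrK lef_pV2// posrE// invr_gt0.
  move=> x /=; rewrite in_itv /= => /andP[x1 x2].
  by rewrite /e /smooth_bump ler_pM ?expR_ge0// F//; lra.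
by apply: Itg_subset => //; [exact: intg_bump|move=> x _; exact: smooth_bump_ge0].
Qed.

(** A smooth transition from 0 to the mass of the bump, which is left unnormalised; only differences
    of rescaled copies, where the plateaus cancel, serve as test functions. *)
Definition step x : R := Itg `]-oo, x] smooth_bump.

Lemma is_derive_step x : is_derive x (1:R) step (smooth_bump x).
Proof.
have := @continuous_FTC1 R smooth_bump -oo%O x (x + 1).
have -> : x < x + 1 by rewrite ltrDl.
move=> /(_ isT (intgT _ intg_bump)) /= H.
have [||//|d e] := H; [by []|by rewrite ltNyr|exact: smooth_bump_continuous|].
apply: DeriveDef; first exact: d.
by rewrite -derive1E; exact: e.
Qed.

Lemma step_0 x : x <= 0 -> step x = 0.
Proof.
move=> x0; rewrite /step (Itg_ext (g := fun _ => 0)) ?Itg0// => y /=.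
rewrite in_itv /= le_eqVlt => /predU1P[->|yx].
  move: x0; rewrite le_eqVlt => /predU1P[->|x0]; last by apply: smooth_bump_supp; rewrite negb_and -ltNge x0.
  by rewrite /smooth_bump /flat ltxx mul0r.
by apply: smooth_bump_supp; rewrite negb_and -ltNge (lt_le_trans yx x0).
Qed.

Lemma step_1 x : 1 <= x -> step x = Itg setT smooth_bump.
Proof.
move=> x1; rewrite /step /Itg Rintegral_mkcond; apply: Itg_ext => y _.
rewrite patchE; case: ifPn => // /negP; rewrite inE /= in_itv /= => /negP; rewrite -ltNge => xy.
by rewrite smooth_bump_supp// negb_and -!ltNge (le_lt_trans x1 xy) orbT.
Qed.

Lemma Ck_step k : Ck k step.
Proof. by apply: Ck_pred; exists smooth_bump; [exact: is_derive_step|exact: Ck_bump]. Qed.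

End Smooth.

(** * Weak derivatives *)

Section Weak.
Variable R : realType.
Local Notation mu := (@lebesgue_measure R).
Implicit Types (f g h w : R -> R) (a b c x y : R).

Lemma test_AC (phi : R -> R) : test_fun R phi ->
  AC phi (derive1 phi) /\ exists M : R, [/\ 0 <= M, forall x, ~~ (- M <= x <= M) -> phi x = 0 &
    forall x, ~~ (- M <= x <= M) -> derive1 phi x = 0].
Proof.
move=> [sm [M0 phi0]].
have d1 x : derivable phi x 1 := sm 0%N x.
have d2 x : derivable (derive1 phi) x 1 := sm 1%N x.
split.
  apply: C1_AC; first by move=> x; rewrite derive1E; exact: derivableP.
  by move=> x; apply/differentiable_continuous/derivable1_diffP.
have out (x : R) : ~~ (- `|M0| <= x <= `|M0|) -> M0 < `|x|.
  by rewrite -ler_norml -ltNge; apply: le_lt_trans; exact: ler_norm.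
exists `|M0|; split=> // x /out Mx; first exact: phi0.
rewrite derive1E; have [_ <-] : is_derive x (1:R) phi 0; last by [].
apply: near_eq_is_derive (is_derive_cst 0 x 1); near=> y; rewrite /= phi0//.
near: y; have := @norm_continuous R R^o x; move/cvgr_gt; exact.
Unshelve. all: by end_near. Qed.

(** The product [f * phi] is absolutely continuous with compact support, so its derivative
    integrates to 0. This shows that derivatives in the sense of [AC] are weak derivatives. *)
Lemma AC_test_by_parts f g (phi : R -> R) : AC f g -> test_fun R phi ->
  [/\ intg setT (fun x => f x * derive1 phi x), intg setT (fun x => g x * phi x) &
  Itg setT (fun x => f x * derive1 phi x) = - Itg setT (fun x => g x * phi x)].
Proof.
move=> Af /test_AC [Ap [M [M0 s1 s2]]]; have [_ gi _] := Af; have [_ pi _] := Ap.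
have i1 : intg setT (fun x => f x * derive1 phi x).
  apply: (@intg_support _ _ (- M) M); last by move=> x /s2 ->; rewrite mulr0.
  by apply: (intg_ext _ (AC_mul_loc Af (pi _ _))) => // x _; rewrite mulrC.
have i2 : intg setT (fun x => g x * phi x).
  by apply: (@intg_support _ _ (- M) M); [exact: AC_mul_loc Ap (gi _ _)|move=> x /s1 ->; rewrite mulr0].
split=> //; apply/eqP; rewrite -addr_eq0 addrC -ItgD//; apply/eqP.
apply: AC_Itg_eq0 (AC_M Af Ap) _ _; last exact: intgD.
apply: (@intg_support _ _ (- M) M); last by move=> x /s1 ->; rewrite mulr0.
exact: AC_loc (AC_M Af Ap).
Qed.

(** An approximate identity at [a], one-sided with support in [[a, a + 1/k]]; its mass is that of
    the bump for all [k] and [a]. *)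
Definition kern k a x : R := k * smooth_bump (k * x + - (k * a)).

Lemma kern_ge0 k a x : 0 < k -> 0 <= kern k a x.
Proof. by move=> k0; rewrite mulr_ge0 ?smooth_bump_ge0// ltW. Qed.

Lemma kern_le k a x : 0 < k -> kern k a x <= k.
Proof. by move=> k0; rewrite -[X in _ <= X]mulr1 ler_wpM2l ?smooth_bump_le1// ltW. Qed.

Lemma kern_supp k a x : 0 < k -> ~~ (a <= x <= a + k^-1) -> kern k a x = 0.
Proof.
move=> k0; rewrite negb_and -!ltNge => H; rewrite /kern smooth_bump_supp ?mulr0//.
rewrite negb_and -!ltNge -mulrBr; case/orP: H => H.
  by rewrite pmulr_rlt0// subr_lt0 H.
by rewrite -ltr_pdivrMl// mulr1 ltrBrDl H orbT.
Qed.

Lemma kern_continuous k a : continuous (kern k a).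
Proof.
move=> x; have [f' df _] : Ck 1 (kern k a) by apply/CkZ/Ck_affine/Ck_bump.
by apply/differentiable_continuous/derivable1_diffP; have [] := df x.
Qed.

Lemma kern_measurable k a : measurable_fun setT (kern k a).
Proof. exact: continuous_measurable_fun (@kern_continuous k a). Qed.

Lemma is_derive_step_affine k a x : is_derive x (1:R) (fun y => step (k * y + - (k * a))) (kern k a x).
Proof. exact: is_derive_affine (is_derive_step _). Qed.

Lemma intg_mul_kern k a w : 0 < k -> (forall c d, intg `[c, d] w) -> intg setT (fun x => w x * kern k a x).
Proof.
move=> k0 wi; apply: (@intg_support _ _ a (a + k^-1)); last by move=> x /(kern_supp k0) ->; rewrite mulr0.
apply: (@intg_mul_bounded _ _ _ _ k) => //.
  by apply: measurable_funTS; exact: kern_measurable.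
by move=> x _; rewrite ger0_norm ?kern_ge0// kern_le.
Qed.

Lemma Itg_kern k a : 0 < k -> Itg setT (kern k a) = Itg setT (@smooth_bump R).
Proof.
move=> k0; have ik : 0 < k^-1 by rewrite invr_gt0.
rewrite (@Itg_support _ _ a (a + k^-1)); last by move=> x; exact: kern_supp.
have A : AC (fun y => step (k * y + - (k * a))) (kern k a).
  by apply: C1_AC; [exact: is_derive_step_affine|exact: kern_continuous].
rewrite (AC_Itg A) ?lerDl ?ltW// subrr [X in _ - X]step_0// subr0 step_1//.
by rewrite mulrDr mulfV ?gt_eqF// addrAC subrr add0r.
Qed.

(** To the right of both transitions the two steps have the same value, so their difference has
    compact support: a difference of two kernels is the derivative of a test function. *)
Lemma test_step_difference k a b : 0 < k ->
  let phi x := step (k * x + - (k * a)) + -1 * step (k * x + - (k * b)) in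
  test_fun R phi /\ derive1 phi = (fun x => kern k a x + -1 * kern k b x).
Proof.
move=> k0 phi; split; last first.
  apply: is_derive_derive1 => x; apply: is_deriveD; first exact: is_derive_step_affine.
  exact: (is_deriveZ (-1) (is_derive_step_affine k b x)).
split.
  apply: Ck_test => n; apply: CkD; last apply: CkZ; apply: Ck_affine; exact: Ck_step.
exists (`|a| + `|b| + k^-1) => x; rewrite /phi.
have ik : 0 < k^-1 by rewrite invr_gt0.
have ha := ler_norm a; have hb := ler_norm b; have ha' := ler_norm (- a); have hb' := ler_norm (- b).
rewrite !normrN in ha' hb'; have na := normr_ge0 a; have nb := normr_ge0 b.
rewrite -!mulrBr; have [x0|x0] := leP 0 x => H; [rewrite (ger0_norm x0) in H|rewrite (ltr0_norm x0) in H].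
  have H1 c : `|c| <= `|a| + `|b| -> 1 <= k * (x - c).
    move=> hc; rewrite -ler_pdivrMl// mulr1; have := ler_norm c; lra.
  by rewrite !step_1 ?H1//; [ring|lra|lra].
have H1 c : `|c| <= `|a| + `|b| -> k * (x - c) <= 0.
  move=> hc; rewrite pmulr_rle0//; have := ler_norm (- c); rewrite normrN; lra.
by rewrite !step_0 ?H1//; [ring|lra|lra].
Qed.

Lemma Itg_kern_lebesgue_pt w a : measurable_fun setT w -> (forall c d, intg `[c, d] w) -> lebesgue_pt w a ->
  Itg setT (fun x => w x * kern n.+1%:R a x) @[n --> \oo] --> w a * Itg setT (@smooth_bump R).
Proof.
move=> mw wi wa.
have di c d : intg `[c, d] (fun x => `|w x - w a|).
  by apply: intg_norm => //; apply: intgB => //; exact: intg_cst.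
have dB r : intg (ball a r) (fun x => `|w x - w a|).
  apply: intgS (di (a - r) (a + r)) => //; first exact: measurable_ball.
  move=> x; rewrite -ball_normE /= ltr_norml in_itv /= => /andP[? ?]; by apply/andP; split; lra.
(* The radius is [2/k] with [k = n + 1], so that the open ball contains the closed support
   [[a, a + 1/k]] of the kernel. Its measure is [4/k], and since the kernel is at most [k], the
   error is at most 4 times the mean deviation over the ball. *)
pose r n : R := 2 / n.+1%:R.
have r0 n : 0 < r n by rewrite divr_gt0// ltr0n.
have dE n : davg w a (r n) = ((r n *+ 2)^-1 * Itg (ball a (r n)) (fun x => `|w x - w a|))%:E.
  rewrite /davg /iavg lebesgue_measure_ball ?ltW// inver gt_eqF ?mulrn_wgt0//.
  by rewrite EFinM EFin_Itg//; exact: measurable_ball.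
have c1 : ((r n *+ 2)^-1 * Itg (ball a (r n)) (fun x => `|w x - w a|)) @[n --> \oo] --> (0:R).
  apply: (fine_cvg (f := fun n => ((r n *+ 2)^-1 * Itg (ball a (r n)) (fun x => `|w x - w a|))%:E)).
  under eq_cvg do rewrite -dE.
  have rc : r n @[n --> \oo] --> (0 : R).
    rewrite -[X in _ --> X](mulr0 2); apply: cvgMr; exact: (@cvg_harmonic R).
  have {}rc : r n @[n --> \oo] --> (0 : R)^'+.
    by move=> A HA; have := rc _ HA; apply: (@filterS nat \oo) => n /(_ (r0 n)).
  exact: cvg_comp rc wa.
have c2 : 4 * ((r n *+ 2)^-1 * Itg (ball a (r n)) (fun x => `|w x - w a|)) @[n --> \oo] --> (0:R).
  by rewrite -[X in _ --> X](mulr0 4); apply: cvgMr.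
apply/subr_cvg0; apply/norm_cvg0P; apply: (squeeze_cvgr _ (cvg_cst 0) c2).
apply: nearW => n; rewrite normr_ge0 /=.
have k0 : 0 < n.+1%:R :> R by rewrite ltr0n.
rewrite -(Itg_kern a k0); set k := n.+1%:R in k0 *.
have ik : intg setT (kern k a).
  have := intg_mul_kern a k0 (fun c d => @intg_cst _ c d 1); move/intg_ext; apply => // x _.
  by rewrite mul1r.
rewrite -ItgZ// -ItgB//; [|exact: intg_mul_kern|exact: intgZ].
have iB : intg setT (fun x => w x * kern k a x - w a * kern k a x).
  by apply: intgB => //; [exact: intg_mul_kern|exact: intgZ].
apply: (le_trans (le_norm_Itg _ iB)) => //.
rewrite (@Itg_support _ _ a (a + k^-1)); last first.
  by move=> x /(kern_supp k0) ->; rewrite !mulr0 subr0 normr0.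
apply: (@le_trans _ _ (Itg `[a, a + k^-1] (fun x => k * `|w x - w a|))).
  apply: le_Itg => //; [by apply: intgT => //; exact: intg_norm|exact: intgZ|].
  by move=> x _; rewrite -mulrBl normrM mulrC (ger0_norm (kern_ge0 a x k0)) ler_wpM2r// kern_le.
rewrite ItgZ//.
have -> : 4 * ((r n *+ 2)^-1 * Itg (ball a (r n)) (fun x => `|w x - w a|)) =
   k * Itg (ball a (r n)) (fun x => `|w x - w a|).
  rewrite /r -/k mulrA; congr (_ * _); rewrite -mulr_natr; field; rewrite gt_eqF//.
apply: ler_wpM2l; first exact: ltW.
apply: Itg_subset => //; first exact: measurable_ball.
have ik' : 0 < k^-1 by rewrite invr_gt0.
move=> x /=; rewrite in_itv /= -ball_normE /= ltr_norml /r -/k => /andP[].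
by move: (k^-1) ik' => z z0 x1 x2; apply/andP; split; lra.
Qed.

(** After subtraction of a primitive of [g], the remainder [w] has weak derivative 0. Its kernel
    averages at any two points therefore agree at every scale, and at Lebesgue points they converge
    to the values of [w]. *)
Lemma du_bois_reymond f g : L2r f -> L2r g ->
  (forall phi, test_fun R phi -> Itg setT (fun x => f x * derive1 phi x) = - Itg setT (fun x => g x * phi x)) ->
  exists F, AC F g /\ {ae mu, forall x, f x = F x}.
Proof.
move=> Lf Lg H.
have [G AG] := AC_primitive (proj1 Lg) (fun a b => L2r_loc a b Lg).
pose w x := f x - G x.
have mw : measurable_fun setT w.
  by apply: measurable_funB; [case: Lf|exact: AC_measurable AG].
have wi c d : intg `[c, d] w by apply: intgB => //; [exact: L2r_loc|exact: AC_loc AG].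
have L : {ae mu, forall x, lebesgue_pt w x}.
  apply: lebesgue_differentiation; split=> //; first exact: openT.
  move=> K _ cK; have [M [_ MK]] := compact_bounded cK.
  pose N := M + 1.
  have KN : K `<=` `[- N, N].
    move=> x Kx /=; rewrite in_itv /= -ler_norml; apply: (MK N) => //; rewrite /N; lra.
  have /integrableP[mwN] := wi (- N) N; apply: le_lt_trans.
  apply: ge0_subset_integral => //=; first exact: compact_measurable.
  by apply/measurable_EFinP; apply: measurableT_comp => //; exact/measurable_EFinP.
have eqw a b : lebesgue_pt w a -> lebesgue_pt w b -> w a = w b.
  move=> wa wb;
  have E n : Itg setT (fun x => w x * kern n.+1%:R a x) = Itg setT (fun x => w x * kern n.+1%:R b x).
    have k0 : 0 < n.+1%:R :> R by rewrite ltr0n.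
    have [tp dp] := test_step_difference a b k0.
    have [i1 i2 e] := AC_test_by_parts AG tp.
    have e2 := H _ tp.
    apply/eqP; rewrite -subr_eq0 -ItgB//; [|exact: intg_mul_kern|exact: intg_mul_kern].
    rewrite (Itg_ext (g := fun x => f x * derive1 (fun x => step (n.+1%:R * x + - (n.+1%:R * a)) + -1 * step (n.+1%:R * x + - (n.+1%:R * b))) x - G x * derive1 (fun x => step (n.+1%:R * x + - (n.+1%:R * a)) + -1 * step (n.+1%:R * x + - (n.+1%:R * b))) x)); last first.
      by move=> x _; rewrite dp /w; ring.
    rewrite ItgB// ?e ?e2 ?subrr//.
    have lk c : intg setT (fun x => f x * kern n.+1%:R c x) by apply: intg_mul_kern => // *; exact: L2r_loc.
    by apply: (intg_ext _ (intgB _ (lk a) (lk b))) => // x _; rewrite dp; ring.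
  apply: (mulIf (lt0r_neq0 (@Itg_bump_gt0 R))).
  have ca := Itg_kern_lebesgue_pt mw wi wa; rewrite (funext E) in ca.
  exact: (cvg_unique (@norm_hausdorff _ _) ca (Itg_kern_lebesgue_pt mw wi wb)).
(* If no Lebesgue point existed, the almost-everywhere statement [L] would hold of an empty set of
   points and any conclusion would follow almost everywhere. *)
have [[a wa]|no] := pselect (exists a, lebesgue_pt w a).
  exists (fun x => G x + w a); split.
    by apply: AC_ext (AC_D AG (AC_cst (w a))) _ _ => // x; rewrite addr0.
  by apply: ae_imp L => x wx; rewrite -(eqw _ _ wx wa) /w; ring.
exists G; split=> //; apply: ae_imp L => x wx; exfalso; apply: no; by exists x.
Qed.

End Weak.

(** * Geometrically convergent series in L2 *)

Section Neumann.
Variable R : realType.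
Local Notation mu := (@lebesgue_measure R).
Implicit Types (f g h : R -> R) (a b c x y : R).

(** The pointwise limit may be infinite, but monotone convergence bounds its integral by [K]; it is
    then finite almost everywhere and [fine] of it is the majorant. *)
Lemma beppo_levi (T : nat -> R -> R) K : (forall n, intg setT (T n)) ->
  (forall n x, 0 <= T n x) -> (forall n x, T n x <= T n.+1 x) -> (forall n, Itg setT (T n) <= K) ->
  exists S, intg setT S /\ {ae mu, forall x, forall n, T n x <= S x}.
Proof.
move=> Ti T0 nd TK.
have ndT x : nondecreasing_seq (fun n => (T n x)%:E).
  by apply/nondecreasing_seqP => n; rewrite lee_fin.
pose E x : \bar R := limn (fun n => (T n x)%:E).
have cE x : cvgn (fun n => (T n x)%:E) by exact: ereal_nondecreasing_is_cvgn.
have TE n x : ((T n x)%:E <= E x)%E.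
  by apply: lime_ge => //; exists n => // m /= nm; exact: ndT.
have mT n : measurable_fun setT (fun x => (T n x)%:E).
  by apply/measurable_EFinP; exact: intg_mfun (Ti n).
have mE : measurable_fun setT E 
  by apply: (emeasurable_fun_cvg (fun n x => (T n x)%:E)) => //= x _; exact: cE.
have iE : mu.-integrable setT E.
  apply/integrableP; split => //.
  have -> : (\int[mu]_x `|E x| = \int[mu]_x E x)%E.
    by apply: eq_integral => x _; rewrite gee0_abs//; apply: le_trans (TE 0%N x); rewrite lee_fin.
  rewrite (@monotone_convergence _ _ _ mu _ measurableT (fun n x => (T n x)%:E))//.
  - apply: (@le_lt_trans _ _ K%:E); last exact: ltry.
    apply: lime_le.
      apply: ereal_nondecreasing_is_cvgn; apply/nondecreasing_seqP => n.
      by rewrite -!EFin_Itg// lee_fin; exact: le_Itg.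
    by apply: nearW => n; rewrite -EFin_Itg// lee_fin.
  - by move=> n x _; rewrite lee_fin.
have aE : {ae mu, forall x, E x \is a fin_num}.
  by have := integrable_ae measurableT iE; apply: ae_imp => x; exact.
exists (fine \o E); split; last first.
  by apply: ae_imp aE => x fx n; rewrite -lee_fin /= fineK.
apply/integrableP; split; first by apply/measurable_EFinP; exact: measurableT_comp.
case/integrableP : iE => _; apply: le_lt_trans.
apply: ge0_le_integral => //.
- by apply/measurable_EFinP; apply: measurableT_comp => //; exact: measurableT_comp.
- exact: measurableT_comp.
- move=> x _; change (`|(fine (E x))%:E| <= `|E x|)%E.
  by case: (E x) => [y| |] //=; rewrite leey.
Qed.

(** Cauchy-Schwarz with weights [r^i], whose sum is at most [1 / (1 - r)]. The induction step is
    convexity of the square: [(u + A)^2 <= u^2 / (1 - r) + A^2 / r]. *)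
Lemma weighted_sum_sqr r (u : nat -> R) n : 0 < r < 1 ->
  (\sum_(i < n) u i) ^+ 2 <= (1 - r)^-1 * \sum_(i < n) r ^- i * u i ^+ 2.
Proof.
move=> /andP[r0 r1]; elim: n u => [|n IH] u; first by rewrite !big_ord0 expr0n mulr0.
rewrite !big_ord_recl expr0 invr1 mul1r; have := IH (fun i => u i.+1).
set A := \sum_(i < n) u i.+1; set B := \sum_(i < n) r ^- i * u i.+1 ^+ 2 => AB.
have -> : \sum_(i < n) r ^- lift ord0 i * u (lift ord0 i) ^+ 2 = r^-1 * B.
  by rewrite mulr_sumr; apply: eq_bigr => i _; rewrite lift0 exprS invfM mulrA.
have s0 : 0 < 1 - r by rewrite subr_gt0.
have conv : (u 0%N + A) ^+ 2 <= (1 - r)^-1 * u 0%N ^+ 2 + r^-1 * A ^+ 2.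
  rewrite -subr_ge0.
  have -> : (1 - r)^-1 * u 0%N ^+ 2 + r^-1 * A ^+ 2 - (u 0%N + A) ^+ 2 =
     (r * u 0%N - (1 - r) * A) ^+ 2 / (r * (1 - r)) by field; rewrite !gt_eqF.
  by rewrite divr_ge0 ?sqr_ge0// mulr_ge0 ?(ltW r0) ?(ltW s0).
have AB' : r^-1 * A ^+ 2 <= r^-1 * ((1 - r)^-1 * B) by rewrite ler_wpM2l// invr_ge0 ltW.
apply: (le_trans conv); rewrite mulrDr [X in _ <= _ + X]mulrCA.
exact: lerD (lexx _) AB'.
Qed.

Lemma L2r_series (u : nat -> R -> R) (C q : R) : 0 <= q < 1 -> 0 <= C -> (forall n, L2r (u n)) ->
  (forall n, Itg setT (fun x => u n x ^+ 2) <= C * q ^+ n) ->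
  exists s, L2r s /\
    Itg setT (fun x => (s x - \sum_(i < n) u i x) ^+ 2) @[n --> \oo] --> (0:R).
Proof.
move=> /andP[q0 q1] C0 Lu uC.
(* A rate strictly between [q] and 1: the integrals of [r^-i u_i^2] remain summable because
   [q / r < 1], while [r^M] still makes the tails small. *)
pose r := (1 + q) / 2.
have r0 : 0 < r by rewrite /r; lra.
have r1 : r < 1 by rewrite /r; lra.
have qr : q < r by rewrite /r; lra.
have r01 : 0 < r < 1 by rewrite r0.
have s0 : 0 < 1 - r by rewrite subr_gt0.
pose T n x := \sum_(i < n) r ^- i * u i x ^+ 2.
have tE i x : 0 <= r ^- i * u i x ^+ 2 by rewrite mulr_ge0 ?sqr_ge0// invr_ge0 exprn_ge0// ltW.
have TS n x : T n.+1 x = T n x + r ^- n * u n x ^+ 2 by rewrite /T big_ord_recr.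
have Ti n : intg setT (T n).
  elim: n => [|n IH].
    by apply: (intg_ext (f := fun _ => 0)) => //; [exact: (integrable0 mu)|move=> x _; rewrite /T big_ord0].
  apply: (intg_ext (f := fun x => T n x + r ^- n * u n x ^+ 2)) => //.
    by apply: intgD => //; apply: intgZ => //; case: (Lu n).
have T0 n x : 0 <= T n x by apply: sumr_ge0.
have TK n : Itg setT (T n) <= C / (1 - q / r).
  have qr1 : 0 < 1 - q / r by rewrite subr_gt0 ltr_pdivrMr// mul1r.
  apply: (@le_trans _ _ (C * (1 - (q / r) ^+ n) / (1 - q / r))).
    elim: n => [|n IH].
      rewrite (Itg_ext (g := fun _ => 0)); last by move=> x _; rewrite /T big_ord0.
      by rewrite Itg0 expr0 subrr mulr0 mul0r.
    rewrite (Itg_ext (fun x _ => TS n x)) ItgD//; last by apply: intgZ => //; case: (Lu n).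
    rewrite ItgZ//; last by case: (Lu n).
    apply: (@le_trans _ _ (C * (1 - (q / r) ^+ n) / (1 - q / r) + r ^- n * (C * q ^+ n))).
      by apply: lerD => //; rewrite ler_wpM2l// invr_ge0 exprn_ge0// ltW.
    have -> : r ^- n * (C * q ^+ n) = C * (q / r) ^+ n.
      by rewrite (expr_div_n q r n); move: (r ^- n) (q ^+ n) => y z; ring.
    rewrite exprS; move: (q / r) ((q / r) ^+ n) qr1 => z y z1.
    rewrite [X in X <= _](_ : _ = C * (1 - z * y) / (1 - z))//.
    by field; rewrite gt_eqF.
  by rewrite ler_pM2r ?invr_gt0// ler_piMr// gerBl exprn_ge0// divr_ge0// ltW.
have nd n x : T n x <= T n.+1 x by rewrite TS lerDl tE.
(* Cauchy-Schwarz with weights [r^i]: the square of a tail of the series is at most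
   [r^M S / (1 - r)] with the integrable majorant [S]. *)
have [S [Si aS]] := beppo_levi Ti T0 nd TK.
pose sum n x := \sum_(i < n) u i x.
have shift (F : nat -> R) M N : \sum_(M <= i < N) F i = \sum_(i < N - M) F (M + i)%N.
  by rewrite -{1}[M]add0n big_addn big_mkord; apply: eq_bigr => i _; rewrite addnC.
have cut M N x : (M <= N)%N -> sum N x - sum M x = \sum_(i < N - M) u (M + i)%N x.
  move=> MN; rewrite /sum -(big_mkord xpredT (fun i => u i x)) (big_cat_nat (n := M))//= big_mkord.
  by rewrite addrAC subrr add0r shift.
have bound x M N : (forall n, T n x <= S x) -> (M <= N)%N ->
    (sum N x - sum M x) ^+ 2 <= (1 - r)^-1 * r ^+ M * S x.
  move=> TSx MN; rewrite cut//.
  apply: (le_trans (weighted_sum_sqr (fun i => u (M + i)%N x) _ r01)).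
  rewrite -mulrA ler_wpM2l ?invr_ge0 ?(ltW s0)//.
  apply: (@le_trans _ _ (r ^+ M * T N x)); last by rewrite ler_wpM2l// exprn_ge0// ltW.
  rewrite /T -(big_mkord xpredT (fun i => r ^- i * u i x ^+ 2)) (big_cat_nat (n := M))//= mulrDr.
  rewrite -[X in X <= _]add0r; apply: lerD.
    by rewrite mulr_ge0 ?exprn_ge0 ?(ltW r0)// sumr_ge0.
  rewrite shift mulr_sumr; apply: ler_sum => i _.
  rewrite exprD invfM !mulrA mulfV ?mul1r//.
  by rewrite expf_neq0// gt_eqF.
have abound x N : (forall n, T n x <= S x) -> \sum_(i < N) `|u i x| <= 1 + (1 - r)^-1 * S x.
  move=> TSx; have := weighted_sum_sqr (fun i => `|u i x|) N r01.
  have -> : \sum_(i < N) r ^- i * `|u i x| ^+ 2 = T N x.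
    by apply: eq_bigr => i _; rewrite real_normK ?num_real.
  have : (1 - r)^-1 * T N x <= (1 - r)^-1 * S x by rewrite ler_wpM2l// invr_ge0 ltW.
  have := sqr_ge0 (\sum_(i < N) `|u i x| - 1); move: (\sum_(i < N) _) => z; nra.
(* The upper limit is measurable whether or not the series converges, and equals the sum wherever
   [S] dominates; the value of [fine] at infinity concerns only a null set. *)
pose s x := fine (limn_esup (fun n => (sum n x)%:E)).
have msum n : measurable_fun setT (sum n) by apply: measurable_sum => i; case: (Lu i).
have ms : measurable_fun setT s.
  apply: measurableT_comp => //.
  by apply: measurable_fun_limn_esup => n; exact/measurable_EFinP.
have cs x : (forall n, T n x <= S x) -> sum n x @[n --> \oo] --> s x.
  move=> TSx.
  have : cvgn (series (fun n => u n x)).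
    apply: normed_cvg.
    have -> : [normed series (fun n => u n x)] = (fun n => \sum_(i < n) `|u i x|).
      by apply/funext => n; exact: (big_mkord xpredT (fun i => `|u i x|)).
    apply: nondecreasing_is_cvgn.
      by apply/nondecreasing_seqP => n; rewrite big_ord_recr /= lerDl.
    by exists (1 + (1 - r)^-1 * S x) => _ [n _ <-]; exact: abound.
  rewrite (_ : series _ = (fun n => sum n x)); last first.
    by apply/funext => n; exact: (big_mkord xpredT (fun i => u i x)).
  move=> /cvg_ex[l cl].
  have cE : (sum n x)%:E @[n --> \oo] --> l%:E by apply: cvg_EFin => //; exact: nearW.
  by rewrite /s (cvg_limn_einf_sup cE).2.
have sbound x M : (forall n, T n x <= S x) -> (s x - sum M x) ^+ 2 <= (1 - r)^-1 * r ^+ M * S x.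
  move=> TSx.
  have c : (sum n x - sum M x) ^+ 2 @[n --> \oo] --> (s x - sum M x) ^+ 2.
    rewrite expr2; under eq_cvg do rewrite expr2.
    by apply: cvgM; apply: cvgB; (try exact: cs); exact: cvg_cst.
  by apply: (cvgr_to_le c); exists M => // N /= MN; exact: bound.
have mdiff M : measurable_fun setT (fun x => (s x - sum M x) ^+ 2).
  by apply: measurable_funX; apply: measurable_funB.
have idiff M : intg setT (fun x => (s x - sum M x) ^+ 2) /\
   Itg setT (fun x => (s x - sum M x) ^+ 2) <= (1 - r)^-1 * Itg setT (fun x => `|S x|) * r ^+ M.
  have iS : intg setT (fun x => (1 - r)^-1 * r ^+ M * S x) by exact: intgZ.
  (* The bound by [S] holds only almost everywhere. Truncating where it fails gives a function
     dominated at every point and equal almost everywhere to the square. *)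
  pose d x := if (s x - sum M x) ^+ 2 <= (1 - r)^-1 * r ^+ M * S x then (s x - sum M x) ^+ 2 else 0.
  have ed : {ae mu, forall x, setT x -> d x = (s x - sum M x) ^+ 2}.
    by apply: ae_imp aS => x TSx _; rewrite /d sbound.
  have md : measurable_fun setT d.
    apply: measurable_fun_ifT => //.
    by apply: measurable_fun_ler => //; exact: intg_mfun iS.
  have dS x : `|d x| <= `|(1 - r)^-1 * r ^+ M * S x|.
    rewrite /d; case: ifP => h; last by rewrite normr0.
    by rewrite ger0_norm ?sqr_ge0// (le_trans h)// ler_norm.
  have id : intg setT d by apply: (@intg_le _ _ _ (fun x => `|(1 - r)^-1 * r ^+ M * S x|)) => //; exact: intg_norm.
  split; first exact: intg_ae id ed.
  rewrite -(Itg_ae _ md (mdiff M) ed)// mulrAC -ItgZ//; last exact: intg_norm.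
  apply: le_Itg => //; first by apply: intgZ => //; exact: intg_norm.
  move=> x _; apply: (le_trans (ler_norm _)); apply: (le_trans (dS x)).
  rewrite normrM (@ger0_norm _ ((1 - r)^-1 * r ^+ M))// mulr_ge0 ?exprn_ge0 ?(ltW r0)//.
  by rewrite invr_ge0 ltW.
exists s; split.
  split=> //; apply: (intg_ext _ (proj1 (idiff 0%N))) => // x _.
  by rewrite /sum big_ord0 subr0.
have cg := @cvg_geometric R ((1 - r)^-1 * Itg setT (fun x => `|S x|)) r.
have {}cg : (1 - r)^-1 * Itg setT (fun x => `|S x|) * r ^+ n @[n --> \oo] --> (0 : R).
  by apply: cg; rewrite ger0_norm// ltW.
apply: (squeeze_cvgr _ (cvg_cst 0) cg); apply: nearW => n.
by rewrite (idiff n).2 andbT; apply: Itg_ge0 => x _; exact: sqr_ge0.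
Qed.

End Neumann.

(** * Resolvent estimate and Neumann series *)

Section Operator.
Variable R : realType.
Local Notation mu := (@lebesgue_measure R).
Implicit Types (f h p q : R -> R) (a b c x y gamma k l m : R) (g u v : (R -> R) * (R -> R)).

Lemma Dom_lin c p p1 p2 q q1 q2 : Dom p p1 p2 -> Dom q q1 q2 ->
  Dom (fun x => p x + c * q x) (fun x => p1 x + c * q1 x) (fun x => p2 x + c * q2 x).
Proof.
move=> [a1 a2 [l0 l1 l2 lx]] [b1 b2 [m0 m1 m2 mx]].
split; [exact: AC_D a1 (AC_Z c b1)|exact: AC_D a2 (AC_Z c b2)|split].
- exact: L2rD l0 (L2rZ c m0).
- exact: L2rD l1 (L2rZ c m1).
- exact: L2rD l2 (L2rZ c m2).
- by apply: L2r_ext (L2rD lx (L2rZ c mx)) _ => x; ring.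
Qed.

Lemma Dom_xp p p1 p2 : Dom p p1 p2 -> L2r (fun x => x * p x).
Proof.
move=> [a1 _ [[mp p2i] _ _ [_ xi]]].
apply: (L2r_le _ (intgD measurableT p2i xi)); first exact: measurable_funM.
move=> x; rewrite !exprMn; have := sqr_ge0 (x ^+ 2 - 1); have := sqr_ge0 (p x); nra.
Qed.

(** [(x p')^2] is the derivative of [x^2 p p'] minus terms that are products of [L^2] functions, and
    [x^2 p p'] is itself integrable, so no boundary information is required. *)
Lemma Dom_xp1 p p1 p2 : Dom p p1 p2 -> L2r (fun x => x * p1 x).
Proof.
move=> dp; have Lx := Dom_xp dp; have [a1 a2 [l0 l1 l2 lx]] := dp.
have A : AC (fun x => x ^+ 2 * p x * p1 x)
    (fun x => (2 * (x * p x * p1 x) + x ^+ 2 * p x * p2 x) + (x * p1 x) ^+ 2).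
  by apply: AC_ext (AC_M (AC_M (@AC_sqr R) a1) a2) _ _ => // x; ring.
split; first by apply: measurable_funM => //; case: l1.
apply: (AC_nonneg_intg A); first exact: L2r_mul.
  by apply: intgD => //; [apply: intgZ => //; exact: L2r_mul|exact: L2r_mul].
by move=> x; exact: sqr_ge0.
Qed.

Lemma Hop_L2r gamma p p1 p2 : Dom p p1 p2 -> L2r (Hop gamma p p1 p2).
Proof.
move=> dp; have Lx1 := Dom_xp1 dp; have [a1 a2 [l0 l1 l2 lx]] := dp.
have := L2rB (L2rD (L2rZ (- 4^-1) l2) lx) (L2rZ gamma (L2rD (L2rZ 2^-1 l0) Lx1)).
by move/L2r_ext; apply => x; rewrite /Hop; field.
Qed.

Lemma Hop_accretive gamma p p1 p2 : Dom p p1 p2 ->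
  0 <= Itg setT (fun x => Hop gamma p p1 p2 x * p x).
Proof.
move=> dp; have Lx := Dom_xp dp; have Lx1 := Dom_xp1 dp; have [a1 a2 [l0 l1 l2 lx]] := dp.
pose e x := p1 x ^+ 2 / 4 + (x * p x) ^+ 2.
pose d x := - (4^-1) * (p2 x * p x + p1 x * p1 x) +
  - (gamma / 2) * (1 * (p x * p x) + x * (p1 x * p x + p x * p1 x)).
have A : AC (fun x => - (4^-1) * (p1 x * p x) + - (gamma / 2) * (x * (p x * p x))) d.
  by apply: AC_D; apply: AC_Z; [exact: AC_M|apply: AC_M (@AC_id R) (AC_M a1 a1)].
have ie : intg setT e.
  apply: intgD => //; last by case: Lx.
  by apply: (intg_ext _ (intgZ 4^-1 _ (proj2 l1))) => // x _; rewrite mulrC.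
have id : intg setT d.
  apply: intgD => //; apply: intgZ => //.
    by apply: intgD => //; exact: L2r_mul.
  have i1 := L2r_mul l0 l0; have i2 := L2r_mul Lx l1.
  by apply: (intg_ext _ (intgD _ i1 (intgZ 2 _ i2))) => // x _; ring.
have iF : intg setT (fun x => - (4^-1) * (p1 x * p x) + - (gamma / 2) * (x * (p x * p x))).
  apply: intgD => //; apply: intgZ => //; first exact: L2r_mul.
  by apply: (intg_ext _ (L2r_mul Lx l0)) => // x _; ring.
rewrite (Itg_ext (g := fun x => e x + d x)); last by move=> x _; rewrite /Hop /e /d; field.
rewrite ItgD// (AC_Itg_eq0 A iF id) addr0.
by apply: Itg_ge0 => x _; rewrite addr_ge0 ?sqr_ge0// divr_ge0// sqr_ge0.
Qed.

Definition nrm (u : (R -> R) * (R -> R)) : R := Itg setT (fun x => u.1 x ^+ 2 + u.2 x ^+ 2).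
Definition L2p (u : (R -> R) * (R -> R)) : Prop := L2r u.1 /\ L2r u.2.
Definition lin c (u v : (R -> R) * (R -> R)) : (R -> R) * (R -> R) :=
  (fun x => u.1 x + c * v.1 x, fun x => u.2 x + c * v.2 x).
(** Multiplication of [u.1 + i u.2] by the complex number [k1 + i k2]. *)
Definition cmul k1 k2 (u : (R -> R) * (R -> R)) : (R -> R) * (R -> R) :=
  (fun x => k1 * u.1 x - k2 * u.2 x, fun x => k1 * u.2 x + k2 * u.1 x).

(* [u.1 + i u.2] solves [(H - (l + i m)) u = g.1 + i g.2] almost everywhere. *)
Definition Sol gamma l m (g u : (R -> R) * (R -> R)) : Prop :=
  exists p1 p2 q1 q2, [/\ Dom u.1 p1 p2, Dom u.2 q1 q2,
   {ae mu, forall x, Hop gamma u.1 p1 p2 x - l * u.1 x + m * u.2 x = g.1 x} &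
   {ae mu, forall x, Hop gamma u.2 q1 q2 x - l * u.2 x - m * u.1 x = g.2 x}].

Lemma L2p_lin c u v : L2p u -> L2p v -> L2p (lin c u v).
Proof. by move=> [? ?] [? ?]; split; apply: L2rD => //; exact: L2rZ. Qed.

Lemma L2p_cmul k1 k2 u : L2p u -> L2p (cmul k1 k2 u).
Proof. by move=> [? ?]; split; [apply: L2rB|apply: L2rD]; exact: L2rZ. Qed.

Lemma L2p_intg u : L2p u -> intg setT (fun x => u.1 x ^+ 2 + u.2 x ^+ 2).
Proof. by move=> [[_ ?] [_ ?]]; exact: intgD. Qed.

Lemma nrm_ge0 u : 0 <= nrm u.
Proof. by apply: Itg_ge0 => x _; rewrite addr_ge0// sqr_ge0. Qed.

Lemma nrm_cmul k1 k2 u : L2p u -> nrm (cmul k1 k2 u) = (k1 ^+ 2 + k2 ^+ 2) * nrm u.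
Proof.
move=> /L2p_intg ui; rewrite /nrm -ItgZ//; apply: Itg_ext => x _; rewrite /=; ring.
Qed.

Lemma Sol_L2p gamma l m g u : Sol gamma l m g u -> L2p u.
Proof. by move=> [p1 [p2 [q1 [q2 [[_ _ [? _ _ _]] [_ _ [? _ _ _]] _ _]]]]]. Qed.

Lemma Sol_lin gamma l m c g u g' u' : Sol gamma l m g u -> Sol gamma l m g' u' ->
  Sol gamma l m (lin c g g') (lin c u u').
Proof.
move=> [p1 [p2 [q1 [q2 [d1 d2 e1 e2]]]]] [p1' [p2' [q1' [q2' [d1' d2' e1' e2']]]]].
exists (fun x => p1 x + c * p1' x), (fun x => p2 x + c * p2' x),
  (fun x => q1 x + c * q1' x), (fun x => q2 x + c * q2' x); split; [exact: Dom_lin|exact: Dom_lin| |].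
- by apply: ae_imp2 e1 e1' => x; rewrite /Hop /= => <- <-; field.
- by apply: ae_imp2 e2 e2' => x; rewrite /Hop /= => <- <-; field.
Qed.

(** In the pairing with [u] the terms in [m] cancel between the two components. Cauchy-Schwarz is
    used pointwise, as Young's inequality with weight [- l], so that half of [- l * nrm u] is
    absorbed on the left and the constant stays sharp. *)
Lemma Sol_bound gamma l m g u : l < 0 -> L2p g -> Sol gamma l m g u -> l ^+ 2 * nrm u <= nrm g.
Proof.
move=> l0 Lg [p1 [p2 [q1 [q2 [d1 d2 e1 e2]]]]].
have [[mg1 _] [mg2 _]] := Lg.
pose w1 x := Hop gamma u.1 p1 p2 x - l * u.1 x + m * u.2 x.
pose w2 x := Hop gamma u.2 q1 q2 x - l * u.2 x - m * u.1 x.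
have [Lu1 Lu2] : L2r u.1 /\ L2r u.2 by case: d1 d2 => _ _ [? _ _ _] [_ _ [? _ _ _]].
have LH1 := Hop_L2r gamma d1; have LH2 := Hop_L2r gamma d2.
have Lw1 : L2r w1 by apply: L2rD (L2rB LH1 (L2rZ l Lu1)) (L2rZ m Lu2).
have Lw2 : L2r w2 by apply: L2rB (L2rB LH2 (L2rZ l Lu2)) (L2rZ m Lu1).
have -> : nrm g = nrm (w1, w2).
  apply: Itg_ae => //.
  - by apply: measurable_funD; exact: measurable_funX.
  - by apply: measurable_funD; apply: measurable_funX; [case: Lw1|case: Lw2].
  - by apply: ae_imp2 e1 e2 => x; rewrite /= /w1 /w2 => -> ->.
have iw := L2p_intg (conj Lw1 Lw2 : L2p (w1, w2)).
have iu := L2p_intg (conj Lu1 Lu2 : L2p u).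
have i1 := L2r_mul LH1 Lu1; have i2 := L2r_mul LH2 Lu2.
have h1 := Hop_accretive gamma d1; have h2 := Hop_accretive gamma d2.
have L : - l * nrm u <= (2 * - l)^-1 * nrm (w1, w2) + (- l / 2) * nrm u.
  apply: (@le_trans _ _ (Itg setT (fun x => Hop gamma u.1 p1 p2 x * u.1 x +
      Hop gamma u.2 q1 q2 x * u.2 x + - l * (u.1 x ^+ 2 + u.2 x ^+ 2)))).
    rewrite ItgD//; [|exact: intgD|exact: intgZ].
    by rewrite ItgD// ItgZ// -/(nrm u) lerDr addr_ge0.
  rewrite /nrm -ItgZ// -(ItgZ (- l / 2))// -ItgD//; [|exact: intgZ|exact: intgZ].
  apply: le_Itg => //; [by apply: intgD => //; [exact: intgD|exact: intgZ]|by apply: intgD => //; exact: intgZ|].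
  move=> x _ /=; have a0 : 0 < - l by rewrite oppr_gt0.
  have -> : Hop gamma u.1 p1 p2 x * u.1 x + Hop gamma u.2 q1 q2 x * u.2 x + - l * (u.1 x ^+ 2 + u.2 x ^+ 2) =
     w1 x * u.1 x + w2 x * u.2 x by rewrite /w1 /w2; ring.
  rewrite -subr_ge0.
  have -> : (2 * - l)^-1 * (w1 x ^+ 2 + w2 x ^+ 2) + - l / 2 * (u.1 x ^+ 2 + u.2 x ^+ 2) -
     (w1 x * u.1 x + w2 x * u.2 x) =
     ((w1 x - - l * u.1 x) ^+ 2 + (w2 x - - l * u.2 x) ^+ 2) / (2 * - l).
    by field; rewrite lt_eqF.
  by rewrite divr_ge0 ?addr_ge0 ?sqr_ge0// mulr_ge0// ltW.
have a0 : 0 < 2 * - l by rewrite mulr_gt0// oppr_gt0.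
have : - l / 2 * nrm u <= (2 * - l)^-1 * nrm (w1, w2) by lra.
rewrite ler_pdivlMl// => H.
by apply: le_trans H; rewrite le_eqVlt; apply/orP; left; apply/eqP; field.
Qed.

Definition Surj gamma l m : Prop := forall g, L2p g -> exists u, Sol gamma l m g u.

Lemma nrm_eq0_ae u : L2p u -> nrm u = 0 -> {ae mu, forall x, u.1 x = 0 /\ u.2 x = 0}.
Proof.
move=> Lu n0; have : {ae mu, forall x, u.1 x ^+ 2 + u.2 x ^+ 2 = 0}.
  by apply: Itg_eq0_ae => //; [exact: L2p_intg|move=> x; rewrite addr_ge0// sqr_ge0].
apply: ae_imp => x /eqP; rewrite paddr_eq0 ?sqr_ge0// => /andP[].
by rewrite !sqrf_eq0 => /eqP -> /eqP ->.
Qed.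

(* Neumann series: [u = sum_n (kappa (H - lambda)^-1)^n (H - lambda)^-1 g] with [kappa = lambda' - lambda]. *)
Lemma Surj_disc gamma l m l' m' : l < 0 -> (l' - l) ^+ 2 + (m' - m) ^+ 2 < l ^+ 2 ->
  Surj gamma l m -> Surj gamma l' m'.
Proof.
move=> l0 disc S g Lg.
have l2 : 0 < l ^+ 2 by rewrite exprn_even_gt0//= lt_eqF.
pose k1 := l' - l; pose k2 := m' - m.
pose Q := (k1 ^+ 2 + k2 ^+ 2) / l ^+ 2.
have Q0 : 0 <= Q by rewrite divr_ge0 ?addr_ge0 ?sqr_ge0// ltW.
have Q1 : Q < 1 by rewrite ltr_pdivrMr// mul1r.
(* [P] is a bare choice of solutions, not a linear map; linearity enters only through [Sol_lin] and
   uniqueness through [Sol_bound]. *)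
have [P HP] : {P & forall v, L2p v -> Sol gamma l m v (P v)}.
  apply: (@choice _ _ (fun v u => L2p v -> Sol gamma l m v u)) => v.
  by have [/S[u]|nL] := pselect (L2p v); [exists u|exists v].
have LP v : L2p v -> L2p (P v) by move=> /HP; exact: Sol_L2p.
have nP v : L2p v -> nrm (P (cmul k1 k2 v)) <= Q * nrm v.
  move=> Lv; have Lc := L2p_cmul k1 k2 Lv.
  rewrite mulrAC ler_pdivlMr// mulrC -nrm_cmul//.
  exact: Sol_bound l0 Lc (HP _ Lc).
pose u := fix u n := if n is n'.+1 then P (cmul k1 k2 (u n')) else P g.
have Lu n : L2p (u n).
  by elim: n => [|n IH] /=; [exact: LP|apply: LP; exact: L2p_cmul].
have nu n : nrm (u n) <= nrm (P g) * Q ^+ n.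
  elim: n => [|n IH]; first by rewrite expr0 mulr1.
  by rewrite exprS mulrCA; apply: (le_trans (nP _ (Lu n))); rewrite ler_wpM2l.
have n1 n : Itg setT (fun x => (u n).1 x ^+ 2) <= nrm (P g) * Q ^+ n.
  apply: le_trans (nu n); have [[_ i1] [_ i2]] := Lu n.
  by apply: le_Itg => //; [exact: intgD|move=> x _; rewrite lerDl sqr_ge0].
have n2 n : Itg setT (fun x => (u n).2 x ^+ 2) <= nrm (P g) * Q ^+ n.
  apply: le_trans (nu n); have [[_ i1] [_ i2]] := Lu n.
  by apply: le_Itg => //; [exact: intgD|move=> x _; rewrite lerDr sqr_ge0].
have Q01 : 0 <= Q < 1 by rewrite Q0.
have [s1 [Ls1 c1]] := L2r_series Q01 (nrm_ge0 (P g)) (fun n => proj1 (Lu n)) n1.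
have [s2 [Ls2 c2]] := L2r_series Q01 (nrm_ge0 (P g)) (fun n => proj2 (Lu n)) n2.
pose s := (s1, s2).
have Ls : L2p s by [].
pose w := lin 1 g (cmul k1 k2 s).
have Lw : L2p w by apply: L2p_lin => //; exact: L2p_cmul.
pose S_ n : (R -> R) * (R -> R) := (fun x => \sum_(i < n) (u i).1 x, fun x => \sum_(i < n) (u i).2 x).
have SS n : S_ n.+1 = lin 1 (S_ n) (u n).
  by rewrite /S_ /lin /=; congr pair; apply/funext => x; rewrite big_ord_recr /= mul1r.
have SolS n : Sol gamma l m (lin 1 g (cmul k1 k2 (S_ n))) (S_ n.+1).
  elim: n => [|n IH].
    have -> : lin 1 g (cmul k1 k2 (S_ 0%N)) = g.
      rewrite /lin /cmul /S_ [RHS]surjective_pairing /=; congr pair; apply/funext => x;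
      by rewrite !big_ord0 !mulr0 ?subr0 ?addr0 ?mulr0 ?addr0.
    have -> : S_ 1%N = P g.
      rewrite /S_ [RHS]surjective_pairing; congr pair; apply/funext => x;
      by rewrite big_ord_recl big_ord0 addr0.
    exact: HP.
  rewrite (SS n.+1).
  have -> : lin 1 g (cmul k1 k2 (S_ n.+1)) = lin 1 (lin 1 g (cmul k1 k2 (S_ n))) (cmul k1 k2 (u n)).
    by rewrite SS /lin /cmul /=; congr pair; apply/funext => x; ring.
  by apply: Sol_lin => //; apply: HP; exact: L2p_cmul.
have LS n : L2p (S_ n).
  case: n => [|n]; last exact: Sol_L2p (SolS n).
    by split; apply: L2r_ext (L2r_cst0 R) _ => x; rewrite /S_ /= big_ord0.
(* [phi] solves [(H - lambda) phi = g + kappa s] with [s] the sum of the series. Its difference with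
   the partial sum [S_ n.+1] solves the equation with right-hand side [kappa (s - S_ n)], so the
   resolvent bound forces [phi = s] almost everywhere, and then [(H - lambda') phi = g]. *)
pose phi := P w.
have Lphi : L2p phi by exact: LP.
have LsS n : L2p (lin (-1) s (S_ n)) by exact: L2p_lin.
have cS : nrm (lin (-1) s (S_ n)) @[n --> \oo] --> (0 : R).
  rewrite -[X in _ --> X]addr0.
  have -> : (fun n => nrm (lin (-1) s (S_ n))) = (fun n => Itg setT (fun x => (s1 x - \sum_(i < n) (u i).1 x) ^+ 2)
     + Itg setT (fun x => (s2 x - \sum_(i < n) (u i).2 x) ^+ 2)).
    apply/funext => n; rewrite -ItgD//.
    - by apply: Itg_ext => x _; rewrite /= !mulN1r.
    - by apply: (intg_ext _ (proj2 (proj1 (LsS n)))) => // x _; rewrite /= mulN1r.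
    - by apply: (intg_ext _ (proj2 (proj2 (LsS n)))) => // x _; rewrite /= mulN1r.
  exact: cvgD.
have close n : nrm (lin (-1) phi (S_ n.+1)) <= Q * nrm (lin (-1) s (S_ n)).
  have Lc := L2p_cmul k1 k2 (LsS n).
  rewrite mulrAC ler_pdivlMr// mulrC -nrm_cmul//.
  apply: (Sol_bound (m := m) (gamma := gamma) l0 Lc).
  have -> : cmul k1 k2 (lin (-1) s (S_ n)) = lin (-1) w (lin 1 g (cmul k1 k2 (S_ n))).
    by rewrite /w /lin /cmul /=; congr pair; apply/funext => x; ring.
  by apply: Sol_lin => //; exact: HP.
have Ld : L2p (lin (-1) phi s) by exact: L2p_lin.
have d0 : nrm (lin (-1) phi s) = 0.
  apply/eqP; rewrite eq_le nrm_ge0 andbT.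
  have c3 : nrm (lin (-1) s (S_ n.+1)) @[n --> \oo] --> (0 : R).
    by rewrite (cvg_shiftS (fun n => nrm (lin (-1) s (S_ n)))).
  have c4 : 2 * (Q * nrm (lin (-1) s (S_ n))) + 2 * nrm (lin (-1) s (S_ n.+1)) @[n --> \oo] --> (0 : R).
    rewrite -[X in _ --> X]addr0; apply: cvgD.
      by rewrite -[X in _ --> X](mulr0 2); apply: cvgMr; rewrite -[X in _ --> X](mulr0 Q); apply: cvgMr.
    by rewrite -[X in _ --> X](mulr0 2); apply: cvgMr.
  apply: (cvgr_to_ge c4); apply: nearW => n.
  have L1 := L2p_lin (-1) Lphi (LS n.+1); have L2 := L2p_lin (-1) Ls (LS n.+1).
  apply: (@le_trans _ _ (2 * nrm (lin (-1) phi (S_ n.+1)) + 2 * nrm (lin (-1) s (S_ n.+1)))); last first.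
    by rewrite lerD2r ler_wpM2l.
  have [j1 j2] := (L2p_intg L1, L2p_intg L2).
  rewrite /nrm -!ItgZ// -ItgD//; [|exact: intgZ|exact: intgZ].
  apply: le_Itg => //; [exact: L2p_intg|by apply: intgD => //; exact: intgZ|].
  move=> x _ /=; move: (phi.1 x) (phi.2 x) (s1 x) (s2 x) => a b c d.
  move: (\sum_(i < n.+1) (u i).1 x) (\sum_(i < n.+1) (u i).2 x) => e f.
  have := sqr_ge0 (a - e + (c - e)); have := sqr_ge0 (b - f + (d - f)); nra.
have eqs := nrm_eq0_ae Ld d0.
exists phi; have [p1 [p2 [q1 [q2 [d1 d2 e1 e2]]]]] := HP _ Lw.
exists p1, p2, q1, q2; split=> //.
- apply: ae_imp2 eqs e1 => x [] /=.
  rewrite !mulN1r => /subr0_eq z1 /subr0_eq z2; rewrite -/phi => E.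
  move: E; rewrite -z1 -z2 /k1 /k2; lra.
- apply: ae_imp2 eqs e2 => x [] /=.
  rewrite !mulN1r => /subr0_eq z1 /subr0_eq z2; rewrite -/phi => E.
  move: E; rewrite -z1 -z2 /k1 /k2; lra.
Qed.

Lemma Surj_base gamma : Surj gamma (- (Num.sqrt (1 + gamma ^+ 2) / 2)) 0.
Proof.
move=> g [L1 L2].
have [p [p1 [p2 [dp ep]]]] := resolvent_base gamma L1.
have [q [q1 [q2 [dq eq]]]] := resolvent_base gamma L2.
exists (p, q), p1, p2, q1, q2; split=> //=.
- by apply: nearW => x; rewrite mul0r addr0 mulNr opprK ep.
- by apply: nearW => x; rewrite mul0r subr0 mulNr opprK eq.
Qed.

(* The discs [|lambda + a| < a] with [a > 0] exhaust the open left half-plane. *)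
Lemma Surj_all gamma l m : l < 0 -> Surj gamma l m.
Proof.
move=> l0; pose a := Num.sqrt (1 + gamma ^+ 2) / 2 : R.
have a0 : 0 < a by rewrite divr_gt0// sqrtr_gt0 ltr_wpDr// sqr_ge0.
(* The disc around [- b] has radius [b] and contains [- (3/2) b], so the real centre can be moved to
   minus infinity geometrically. *)
have far n : Surj gamma (- (a * (3 / 2) ^+ n)) 0.
  elim: n => [|n IH]; first by rewrite expr0 mulr1; exact: Surj_base.
  have b0 : 0 < a * (3 / 2) ^+ n by rewrite mulr_gt0// exprn_gt0// divr_gt0.
  apply: Surj_disc IH; first by rewrite oppr_lt0.
  rewrite (exprS (3 / 2) n) mulrCA; move: (a * _) b0 => b b0; nra.
(* With [b] the radius, this is [(l + b)^2 + m^2 < b^2] expanded. *)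
have [n hn] : exists n, l ^+ 2 + m ^+ 2 < - (2 * l) * (a * (3 / 2) ^+ n).
  have la0 : 0 < - (2 * l) * a by rewrite mulr_gt0//; lra.
  pose t := (l ^+ 2 + m ^+ 2) / (- (2 * l) * a).
  have bern (k : nat) : 1 + k%:R / 2 <= (3 / 2) ^+ k :> R.
    elim: k => [|k IH]; first by rewrite mul0r addr0 expr0.
    by rewrite exprS -natr1; have := ler0n R k; nra.
  (* The factor 2 compensates the slope [1/2] in the Bernoulli inequality. *)
  exists (2 * Num.bound t)%N; rewrite mulrA -ltr_pdivrMl// mulrC -/t.
  apply: (lt_le_trans _ (bern _)); rewrite natrM.
  have := archi_boundP (_ : 0 <= t); rewrite divr_ge0 ?addr_ge0 ?sqr_ge0 ?(ltW la0)// => /(_ isT).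
  lra.
have b0 : 0 < a * (3 / 2) ^+ n by rewrite mulr_gt0// exprn_gt0// divr_gt0.
apply: Surj_disc (far n); first by rewrite oppr_lt0.
move: (a * _) b0 hn => b b0 hn; nra.
Qed.

End Operator.

(** * Complex-valued functions *)

Section Complex.
Variable R : realType.
Local Notation mu := (@lebesgue_measure R).
Implicit Types (f psi h : R -> R[i]) (gamma x : R).

Lemma L2_components f : L2 R f <-> L2p ((fun x => complex.Re (f x)), (fun x => complex.Im (f x))).
Proof.
split=> [[mr [mi fi]]|[[mr ri] [mi ii]]]; last by split=> //; split=> //; exact: intgD.
by split; apply: (L2r_le _ (fi : intg _ _)) => // x; rewrite /cabs2 ?lerDl ?lerDr sqr_ge0.
Qed.

Lemma Re_cRM (r : R) (z : R[i]) : complex.Re (cR R r * z) = r * complex.Re z.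
Proof. by case: z => a b; rewrite /cR /= mul0r subr0. Qed.

Lemma Im_cRM (r : R) (z : R[i]) : complex.Im (cR R r * z) = r * complex.Im z.
Proof. by case: z => a b; rewrite /cR /= mul0r addr0. Qed.

Lemma cR_inv (r : R) : (cR R r)^-1 = cR R r^-1.
Proof. by rewrite -[cR R r]/(real_complex R r) -fmorphV. Qed.

Lemma Re_H gamma (a b c : R[i]) x :
  complex.Re (- (cR R (1 / 4)) * a + cR R (x ^+ 2) * b - cR R gamma * (b / cR R 2 + cR R x * c)) =
  - (complex.Re a / 4) + x ^+ 2 * complex.Re b - gamma * (complex.Re b / 2 + x * complex.Re c).
Proof.
by rewrite cR_inv (mulrC b) mulNr !raddfD !raddfN /= !Re_cRM raddfD /= !Re_cRM; field.
Qed.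

Lemma Im_H gamma (a b c : R[i]) x :
  complex.Im (- (cR R (1 / 4)) * a + cR R (x ^+ 2) * b - cR R gamma * (b / cR R 2 + cR R x * c)) =
  - (complex.Im a / 4) + x ^+ 2 * complex.Im b - gamma * (complex.Im b / 2 + x * complex.Im c).
Proof.
by rewrite cR_inv (mulrC b) mulNr !raddfD !raddfN /= !Im_cRM raddfD /= !Im_cRM; field.
Qed.

Lemma AC_ae (F f g : R -> R) : AC F f -> measurable_fun setT g ->
  {ae mu, forall x, f x = g x} -> AC F g.
Proof.
move=> [mf fi Ff] mg fg.
have ae D : {ae mu, forall x, D x -> f x = g x} by apply: ae_imp fg.
split=> // [a b|a b ab].
  by apply: (intg_ae _ _ (fi a b) (ae _)) => //; exact: measurable_funTS.
by rewrite Ff//; apply: Itg_ae => //; exact: measurable_funTS.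
Qed.

(** The du Bois-Reymond lemma is applied twice: [d'] is the continuous representative of [d], and
    [u] is a primitive of [d], hence of [d']. The second derivative [e] is kept as given. *)
Lemma Dom_of_weak (p d e : R -> R) : L2r p -> L2r d -> L2r e -> L2r (fun x => x ^+ 2 * p x) ->
  (forall phi, test_fun R phi -> Itg setT (fun x => p x * derive1 phi x) = - Itg setT (fun x => d x * phi x)) ->
  (forall phi, test_fun R phi -> Itg setT (fun x => d x * derive1 phi x) = - Itg setT (fun x => e x * phi x)) ->
  exists u d', [/\ Dom u d' e, {ae mu, forall x, p x = u x} & {ae mu, forall x, d x = d' x}].
Proof.
move=> Lp Ld Le Lx w1 w2.
have [d' [A1 E1]] := du_bois_reymond Ld Le w2.
have [u [A0 E0]] := du_bois_reymond Lp Ld w1.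
have mu_ := AC_measurable A0; have md' := AC_measurable A1.
exists u, d'; split=> //; split=> //; first exact: AC_ae A0 md' E1.
split=> //; [exact: L2r_ae E0|exact: L2r_ae E1|].
apply: (L2r_ae _ Lx); first by apply: measurable_funM => //; exact: measurable_funX.
by apply: ae_imp E0 => x ->.
Qed.

(** From here on [psi] is replaced by a representative with absolutely continuous components.
    Measurability of [psi] and [h] is recorded separately, since integrals are transferred between
    functions that agree only almost everywhere. *)
Lemma Hrel_components gamma psi h : Hrel R gamma psi h -> exists u p1 p2 q1 q2,
  [/\ Dom u.1 p1 p2, Dom u.2 q1 q2,
   measurable_fun setT (fun x => complex.Re (psi x)) /\ measurable_fun setT (fun x => complex.Im (psi x)),
   measurable_fun setT (fun x => complex.Re (h x)) /\ measurable_fun setT (fun x => complex.Im (h x)) &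
   {ae mu, forall x, (complex.Re (psi x) = u.1 x /\ complex.Im (psi x) = u.2 x) /\
     complex.Re (h x) = Hop gamma u.1 p1 p2 x /\ complex.Im (h x) = Hop gamma u.2 q1 q2 x}].
Proof.
move=> [/L2_components[Lr Li] [/L2_components[Lxr Lxi] [d1 [d2 [/L2_components[L1r L1i]
  [/L2_components[L2r_ L2i_] [w1 [w2 hE]]]]]]]].
have Lxr' : L2r (fun x => x ^+ 2 * complex.Re (psi x)) by apply: L2r_ext Lxr _ => x; exact: Re_cRM.
have Lxi' : L2r (fun x => x ^+ 2 * complex.Im (psi x)) by apply: L2r_ext Lxi _ => x; exact: Im_cRM.
have [u [p1 [Du Eu Ep1]]] := Dom_of_weak Lr L1r L2r_ Lxr'
  (fun phi t => proj1 (w1 phi t)) (fun phi t => proj1 (w2 phi t)).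
have [v [q1 [Dv Ev Eq1]]] := Dom_of_weak Li L1i L2i_ Lxi'
  (fun phi t => proj2 (w1 phi t)) (fun phi t => proj2 (w2 phi t)).
have mH (a b c : R -> R) : measurable_fun setT a -> measurable_fun setT b -> measurable_fun setT c ->
    measurable_fun setT (fun x => - (a x / 4) + x ^+ 2 * b x - gamma * (b x / 2 + x * c x)).
  move=> ma mb mc; apply: measurable_funB; first apply: measurable_funD.
  - by apply: measurableT_comp => //; exact: measurable_funM.
  - by apply: measurable_funM => //; exact: measurable_funX.
  - by apply: measurable_funM => //; apply: measurable_funD; exact: measurable_funM.
exists (u, v), p1, (fun x => complex.Re (d2 x)), q1, (fun x => complex.Im (d2 x)); split=> //=.
- by split; [case: Lr|case: Li].
- split.
    rewrite (funext (fun x => congr1 (@complex.Re R) (hE x))) (funext (fun x => Re_H gamma (d2 x) (psi x) (d1 x) x)).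
    by apply: mH; [case: L2r_|case: Lr|case: L1r].
  rewrite (funext (fun x => congr1 (@complex.Im R) (hE x))) (funext (fun x => Im_H gamma (d2 x) (psi x) (d1 x) x)).
  by apply: mH; [case: L2i_|case: Li|case: L1i].
- apply: ae_imp2 (ae_imp2 (fun x => @conj _ _) Eu Ev) (ae_imp2 (fun x => @conj _ _) Ep1 Eq1).
  move=> x [/= e1 e2] [/= e3 e4]; split=> //.
  by rewrite hE Re_H Im_H /Hop e1 e2 e3 e4.
Qed.

(** The way back, for surjectivity: derivatives in the sense of [AC] satisfy the weak formulation
    against every test function. *)
Lemma Hrel_of_Dom gamma (u : (R -> R) * (R -> R)) p1 p2 q1 q2 : Dom u.1 p1 p2 -> Dom u.2 q1 q2 ->
  exists h, Hrel R gamma (fun x => Complex (u.1 x) (u.2 x)) h /\ forall x,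
    complex.Re (h x) = Hop gamma u.1 p1 p2 x /\ complex.Im (h x) = Hop gamma u.2 q1 q2 x.
Proof.
move=> [A1 A2 [L0 L1 L2_ Lx]] [B1 B2 [M0 M1 M2 Mx]].
pose psi x := Complex (u.1 x) (u.2 x).
pose d1 x := Complex (p1 x) (q1 x).
pose d2 x := Complex (p2 x) (q2 x).
pose h x := - (cR R (1 / 4)) * d2 x + cR R (x ^+ 2) * psi x - cR R gamma * (psi x / cR R 2 + cR R x * d1 x).
exists h; split; last by move=> x; rewrite /h Re_H Im_H.
split; first exact/L2_components.
split.
  apply/L2_components; split; [apply: L2r_ext Lx _|apply: L2r_ext Mx _] => x; by rewrite /= ?mul0r ?subr0 ?addr0.
exists d1, d2; split; [exact/L2_components|split; [exact/L2_components|split; [|split=> //]]].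
- by move=> phi t; split; [have [_ _ e] := AC_test_by_parts A1 t|have [_ _ e] := AC_test_by_parts B1 t].
- by move=> phi t; split; [have [_ _ e] := AC_test_by_parts A2 t|have [_ _ e] := AC_test_by_parts B2 t].
Qed.

Lemma L2norm_ae f (u : (R -> R) * (R -> R)) : measurable_fun setT u.1 -> measurable_fun setT u.2 ->
  measurable_fun setT (fun x => complex.Re (f x)) -> measurable_fun setT (fun x => complex.Im (f x)) ->
  {ae mu, forall x, complex.Re (f x) = u.1 x /\ complex.Im (f x) = u.2 x} -> L2norm R f = Num.sqrt (nrm u).
Proof.
move=> m1 m2 mr mi E; rewrite /L2norm; congr Num.sqrt; apply: Itg_ae => //.
- by apply: measurable_funD; exact: measurable_funX.
- by apply: measurable_funD; exact: measurable_funX.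
- by apply: ae_imp E => x [e1 e2] _; rewrite /cabs2 e1 e2.
Qed.

End Complex.

Theorem theorem2 (R : realType) (gamma : R) :
  gamma != 0 -> `|gamma| <= 1 -> @m_accretive_H R gamma.
Proof.
move=> _ _; split=> [psi h /Hrel_components[u [p1 [p2 [q1 [q2 [Du Dv [mr mi] [mhr mhi] E]]]]]] _|].
  have := addr_ge0 (Hop_accretive gamma Du) (Hop_accretive gamma Dv).
  have [_ _ [L1 _ _ _]] := Du; have [_ _ [L2_ _ _ _]] := Dv.
  have H1 := Hop_L2r gamma Du; have H2 := Hop_L2r gamma Dv.
  have i1 := L2r_mul H1 L1; have i2 := L2r_mul H2 L2_.
  rewrite -ItgD// => /le_trans; apply; rewrite le_eqVlt; apply/orP; left; apply/eqP.
  apply: Itg_ae => //; first by apply: intg_mfun; exact: intgD.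
    rewrite (_ : (fun x => _) = (fun x => complex.Re (h x) * complex.Re (psi x) + complex.Im (h x) * complex.Im (psi x))).
      by apply: measurable_funD; exact: measurable_funM.
    by apply/funext => x; case: (h x) (psi x) => [a b] [c d] /=; ring.
  apply: ae_imp E => x [[e1 e2] [e3 e4]] _; rewrite -e1 -e2 -e3 -e4.
  by case: (h x) (psi x) => [a b] [c d] /=; ring.
case=> l m /= l0.
have Resub (a b : R[i]) : complex.Re (a - Complex l m * b) = complex.Re a - l * complex.Re b + m * complex.Im b.
  by case: a b => [a1 a2] [b1 b2] /=; ring.
have Imsub (a b : R[i]) : complex.Im (a - Complex l m * b) = complex.Im a - l * complex.Im b - m * complex.Re b.
  by case: a b => [a1 a2] [b1 b2] /=; ring.
have l2 : 0 < l ^+ 2 by rewrite exprn_even_gt0//= lt_eqF.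
split; [|split] => [g /L2_components Lg|psi h /Hrel_components[u [p1 [p2 [q1 [q2 [Du Dv _ _ E]]]]]] E0|
   psi h /Hrel_components[u [p1 [p2 [q1 [q2 [Du Dv [mr mi] [mhr mhi] E]]]]]]].
- have [u [p1 [p2 [q1 [q2 [Du Dv E1 E2]]]]]] := Surj_all gamma m l0 Lg.
  have [h [Hh hE]] := Hrel_of_Dom gamma Du Dv.
  exists (fun x => Complex (u.1 x) (u.2 x)), h; split=> //.
  apply: ae_imp2 E1 E2 => x /= e1 e2; have [h1 h2] := hE x.
  by apply/eqP; rewrite eq_complex Resub Imsub h1 h2 /= e1 e2 !eqxx.
(* Injectivity is the resolvent estimate with right-hand side 0. *)
- have Z : L2p (R := R) (fun=> 0, fun=> 0) by split; exact: L2r_cst0.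
  have S : Sol gamma l m (fun=> 0, fun=> 0) u.
    exists p1, p2, q1, q2; split=> //.
      apply: ae_imp2 E E0 => x [[e1 e2] [e3 e4]] /(congr1 (@complex.Re R)).
      by rewrite Resub e1 e2 e3.
    apply: ae_imp2 E E0 => x [[e1 e2] [e3 e4]] /(congr1 (@complex.Im R)).
    by rewrite Imsub e1 e2 e4.
  have n0 : nrm u = 0.
    apply/eqP; rewrite eq_le nrm_ge0 andbT -(pmulr_rle0 _ l2).
    apply: (le_trans (Sol_bound l0 Z S)); rewrite /nrm /=.
    by rewrite (Itg_ext (g := fun _ => 0)) ?Itg0// => x _; rewrite expr0n addr0.
  apply: ae_imp2 E (nrm_eq0_ae (Sol_L2p S) n0) => x [[e1 e2] _] [z1 z2].
  by apply/eqP; rewrite eq_complex e1 e2 z1 z2 /= eqxx.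
- have [_ _ [L1 _ _ _]] := Du; have [_ _ [L2_ _ _ _]] := Dv.
  have H1 := Hop_L2r gamma Du; have H2 := Hop_L2r gamma Dv.
  pose w : (R -> R) * (R -> R) := (fun x => Hop gamma u.1 p1 p2 x - l * u.1 x + m * u.2 x,
    fun x => Hop gamma u.2 q1 q2 x - l * u.2 x - m * u.1 x).
  have Lw : L2p w.
    split; first exact: L2rD (L2rB H1 (L2rZ l L1)) (L2rZ m L2_).
    exact: L2rB (L2rB H2 (L2rZ l L2_)) (L2rZ m L1).
  have S : Sol gamma l m w u by exists p1, p2, q1, q2; split=> //; exact: nearW.
  rewrite (@L2norm_ae _ _ u)//; [|by case: L1|by case: L2_|by apply: ae_imp E => x []].
  have [[mw1 _] [mw2 _]] := Lw.
  rewrite (@L2norm_ae _ _ w)//.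
  + rewrite ler_pdivlMr ?normr_gt0 ?lt_eqF// -sqrtr_sqr -sqrtrM ?nrm_ge0//.
    by rewrite ler_sqrt ?nrm_ge0// mulrC; exact: Sol_bound l0 Lw S.
  + rewrite (funext (fun x => Resub (h x) (psi x))).
    by apply: measurable_funD; [apply: measurable_funB => //|]; exact: measurable_funM.
  + rewrite (funext (fun x => Imsub (h x) (psi x))).
    by apply: measurable_funB; [apply: measurable_funB => //|]; exact: measurable_funM.
  + apply: ae_imp E => x [[e1 e2] [e3 e4]].
    by rewrite Resub Imsub e1 e2 e3 e4.
Qed.
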